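(* Let $d\ge 2$, $\sigma>0$, let $L$ be a line in $\mathbb{R}^d$ with a fixed direction, and let $x\in L$. Let $y$ be drawn from the $d$-dimensional Gaussian distribution with mean $\mu\in\mathbb{R}^d$ and covariance $\sigma^2 I_d$. Let $\phi\in[0,\pi]$ denote the angle between $L$ and $x-y$, let $R=\|x-y\|$ and $s=\|x-\mu\|$, and let $f_{\phi\mid R=r}$ denote the density of $\phi$ conditioned on $R=r$, for $r>0$. Then \[ \sup_{\phi\in[0,\pi]} f_{\phi\mid R=r}(\phi)=O\!\left(\sqrt d+\frac{\sqrt{rs}}{\sigma}\right). \] Moreover, if $d\ge 3$, then \[ \sup_{\phi\in(0,\pi)} \frac{f_{\phi\mid R=r}(\phi)}{\sin\phi}=O\!\left(\sqrt d+\frac{rs}{\sigma^2\sqrt d}\right). \] The constants implicit in $O(\cdot)$ are absolute (independent of $d,r,s,\sigma,\mu,x,L$).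
   Context: $\|\cdot\|$ is the Euclidean norm. *)

(* Defs.v *)
From HB Require Import structures.
From mathcomp Require Import all_boot all_order all_algebra.
From mathcomp Require Import all_classical all_reals all_analysis.
Set Implicit Arguments.
Unset Strict Implicit.
Unset Printing Implicit Defensive.
Import Order.TTheory GRing.Theory Num.Theory.
Import numFieldNormedType.Exports.
Local Open Scope classical_set_scope.
Local Open Scope ring_scope.

Definition dotv (R : realType) (d : nat) (u v : 'rV[R]_d) : R :=
  \sum_(i < d) u ord0 i * v ord0 i.

(* MathComp-Analysis endows 'rV[R]_d with the sup norm, hence this definition. *)
Definition enorm (R : realType) (d : nat) (u : 'rV[R]_d) : R :=
  Num.sqrt (dotv u u).

Definition line (R : realType) (d : nat) (p v : 'rV[R]_d) : set 'rV[R]_d :=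
  [set p + t *: v | t in [set: R]].

(* A line is oriented by its direction vector [v], so that its angle with a
   nonzero vector [w] ranges over [0, pi]. If [w = 0] the value is junk. *)
Definition angle (R : realType) (d : nat) (v w : 'rV[R]_d) : R :=
  acos (dotv v w / (enorm v * enorm w)).

(* The law of [y] is N(mu, sigma^2 I_d), i.e. the product of the N(mu_i, sigma^2);
   the second argument of [normal_prob] is the standard deviation. *)
Definition isotropic_gaussian (R : realType) (disp : measure_display)
    (T : measurableType disp) (P : probability T R) (d : nat)
    (mu : 'rV[R]_d) (sigma : R) (y : T -> 'rV[R]_d) : Prop :=
  (forall i, measurable_fun [set: T] (fun t => y t ord0 i)) /\
  forall A : 'I_d -> set R, (forall i, measurable (A i)) ->
    P [set t | forall i, A i (y t ord0 i)] =
    (\prod_(i < d) normal_prob (mu ord0 i) sigma (A i))%E.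

(* [f r] is the density on [0, pi] of the angle [phi] conditioned on
   [rho = r], for every [r > 0]: for Borel A and B,
     P(phi \in A, rho \in B) = E[ 1_B(rho) \int_A f(rho, a) da ].
   This identity determines [f] only almost everywhere; the values at every
   point, and thus suprema, are those of the version that is continuous on
   ]0, +oo[ x [0, pi], which is unique when the law of [rho] has full support
   in ]0, +oo[. *)
Definition conditional_angle_density (R : realType) (disp : measure_display)
    (T : measurableType disp) (P : probability T R)
    (phi rho : T -> R) (f : R -> R -> R) : Prop :=
  [/\ {in `]0, +oo[ & `[0, pi], forall r a, 0 <= f r a},
      {within `]0, +oo[%classic `*` `[0, pi]%classic,
         continuous (fun z : R * R => f z.1 z.2)} &
      forall A B : set R, measurable A -> measurable B ->
        A `<=` `[0, pi]%classic -> B `<=` `]0, +oo[%classic ->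
        P ((phi @^-1` A) `&` (rho @^-1` B)) =
        (\int[P]_(t in rho @^-1` B)
           \int[lebesgue_measure]_(a in A) (f (rho t) a)%:E)%E].

(* Main.v *)
(**
  After a rotation, [v = |v| e_0] and the mean of [z = x - y] lies in the span of [e_0]
  and [e_1]; write [(a, b)] for its coordinates, so that [a^2 + b^2 = s^2]. Polar
  coordinates for the pair formed by [z_0] and the norm of the remaining coordinates
  show that, given [R = r], the angle [t] has a density proportional to
    [G(t) = sin(t)^(d-2) exp(al cos t) J(be sin t)],  [al = a r / sigma^2],
  [be = b r / sigma^2], where [J(c)] is the integral of [exp(c u)] over the unit sphere
  of the hyperplane orthogonal to [e_0]. This normalised [G] is continuous, and any
  other continuous version is bounded by it.

  Let [K = r s / sigma^2] and let [p] be a maximum of [G], say with [p <= pi / 2]. As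
  [J] is log-convex with logarithmic slope in [-1, 1], [G] is bounded below, with
  equality at [p], by a constant times [sin(t)^(d-2) exp(al cos t + B sin t)] for some
  [|B| <= |be|]. The first-order condition at [p] then yields [G >= e^-5 G(p)] on
  [[p, p + w]] with [w = (d - 1 + K)^(-1/2)], hence [G / int G <= 2 e^5 / w], which is
  the first bound. For the second one, apply this to [G / sin], whose exponent is
  [d - 3] and window [w = (d - 2 + K)^(-1/2)]: on [[p + w / 2, p + w]] moreover
  [sin t >= sqrt(d - 2) w / 8], which compares [int G] with [G(t) / sin t].
*)
Require Import Defs.
From HB Require Import structures.
From mathcomp Require Import all_boot all_order all_algebra.
From mathcomp Require Import all_classical all_reals all_analysis.
From mathcomp Require Import measurable_realfun ring lra.
Set Implicit Arguments.
Unset Strict Implicit.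
Unset Printing Implicit Defensive.
Set SsrOldRewriteGoalsOrder.
Import Order.TTheory GRing.Theory Num.Theory.
Import numFieldNormedType.Exports.
Local Open Scope classical_set_scope.
Local Open Scope ring_scope.

(** The law of [y] is given on boxes only and the conditional density is tested on rectangles only,
    so laws are identified by comparing measures on a generating class. Spherical coordinates of R^d
    are never introduced: coordinates are absorbed one at a time, from the last to the first, each
    by planar polar coordinates. The constants that arise are left unevaluated, since normalisation
    removes them. [J] enters the estimates through tangent exponentials instead of derivatives: it
    is a positive mixture of exp(c u) with |u| <= 1, and exp(y) >= 1 + y, with slope the tilted mean
    of u, gives a minorant touching [J] at a chosen point. The exponent then becomes al cos t + B
    sin t, a sinusoid of amplitude at most K whose shifts are explicit. A single inequality for
    shifts of sin(t)^k exp(al cos t + B sin t) yields both the first-order condition and the bound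
    near the peak; w is the scale at which its quadratic loss stays bounded. *)

Section ereal_valued_integrals.
Local Open Scope ereal_scope.

(** * Measures with a density, image measures, and integration against them *)

Section density.
Import HBNNSimple.

(** The integration formula is checked on simple functions, where it reduces to indicators, and
    passes to the limit by monotone convergence along [nnsfun_approx]. *)
Lemma density_measure d (T : measurableType d) (R : realType)
    (m : {measure set T -> \bar R}) (g : T -> R) :
  measurable_fun [set: T] g -> (forall x, (0 <= g x)%R) ->
  exists nu : {measure set T -> \bar R},
    (forall A, nu A = \int[m]_(x in A) (g x)%:E) /\
    (forall h : T -> \bar R, measurable_fun [set: T] h -> (forall x, 0 <= h x) ->
      \int[nu]_x h x = \int[m]_x (h x * (g x)%:E)).
Proof.
move=> mg g0.
have mEg : measurable_fun [set: T] (EFin \o g) by exact/measurable_EFinP.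
have Eg0 x : 0 <= (g x)%:E by rewrite lee_fin.
pose nu (A : set T) := \int[m]_(x in A) (g x)%:E.
have nu0 : nu set0 = 0 by rewrite /nu integral_set0.
have nu_ge0 A : 0 <= nu A by apply: integral_ge0.
have nusa : semi_sigma_additive nu.
  move=> A mA tA mUA.
  rewrite /nu ge0_integral_bigcup//; last exact: measurable_funTS.
  by apply: is_cvg_ereal_nneg_natsum_cond => n _ _; exact: nu_ge0.
pose nuM := isMeasure.Build d T R nu nu0 nu_ge0 nusa.
pose nup : {measure set T -> \bar R} := HB.pack nu nuM.
exists nup; split=> // h mh h0.
pose h_ := nnsfun_approx measurableT mh.
have h_cvg x : (h_ n x)%:E @[n --> \oo] --> h x by apply: cvg_nnsfun_approx.
transitivity (limn (fun n => \int[nup]_x (h_ n x)%:E)).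
  rewrite -monotone_convergence//.
  - by apply: eq_integral => x _; apply/esym/cvg_lim => //; exact: h_cvg.
  - by move=> n; exact/measurable_EFinP/measurable_funP.
  - by move=> n x _; rewrite lee_fin.
  - by move=> x _ a b ab; rewrite lee_fin; exact/lefP/nd_nnsfun_approx.
transitivity (limn (fun n => \int[m]_x ((h_ n x)%:E * (g x)%:E))); last first.
  rewrite -monotone_convergence//.
  - apply: eq_integral => x _; apply/cvg_lim => //.
    by apply: cvgeZr => //; exact: h_cvg.
  - move=> n; apply: emeasurable_funM => //.
    exact/measurable_EFinP/measurable_funP.
  - by move=> n x _; rewrite mule_ge0// lee_fin.
  - move=> x _ a b ab; apply: lee_wpmul2r => //.
    by rewrite lee_fin; exact/lefP/nd_nnsfun_approx.
congr (limn _); apply/funext => n.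
under eq_integral do rewrite fimfunE -fsumEFin//.
rewrite ge0_integral_fsum//; last 2 first.
- by move=> r; exact/measurable_EFinP/measurable_funM.
- by move=> r x _; rewrite nnfun_muleindic_ge0.
transitivity (\int[m]_x (\sum_(r \in range (h_ n))
    ((r * \1_(h_ n @^-1` [set r]) x)%:E * (g x)%:E))); last first.
  apply: eq_integral => x _; rewrite fimfunE -fsumEFin// ge0_mule_fsuml//.
  by move=> r; rewrite nnfun_muleindic_ge0.
rewrite ge0_integral_fsum//; last 2 first.
- move=> r; apply: emeasurable_funM => //.
  exact/measurable_EFinP/measurable_funM.
- by move=> r x _; rewrite mule_ge0// nnfun_muleindic_ge0.
apply: eq_fsbigr => r /set_mem[x _ <-].
rewrite integralZl_indic_nnsfun// integral_indic// setIT /= /nu.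
under [RHS]eq_integral do rewrite EFinM -muleA.
rewrite ge0_integralZl//; last 3 first.
- apply: emeasurable_funM => //.
  exact/measurable_EFinP/measurable_indic.
- by move=> y _; rewrite mule_ge0// lee_fin.
- by rewrite lee_fin.
congr (_ * _); rewrite integral_mkcond; apply: eq_integral => y _.
by rewrite /patch indicE; case: ifP => _; rewrite ?mul1e ?mul0e.
Qed.

End density.

Lemma image_measure d d' (T : measurableType d) (T' : measurableType d')
    (R : realType) (m : {measure set T -> \bar R}) (phi : T -> T') :
  measurable_fun [set: T] phi ->
  exists nu : {measure set T' -> \bar R},
    (forall A, nu A = m (phi @^-1` A)) /\
    (forall h : T' -> \bar R, measurable_fun [set: T'] h -> (forall x, 0 <= h x) ->
      \int[nu]_x h x = \int[m]_x h (phi x)).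
Proof.
move=> mphi.
unshelve eexists (pushforward m phi : {measure set T' -> \bar R}) => //.
split=> // h mh h0.
by rewrite (ge0_integral_pushforward mphi).
Qed.

Lemma measurable_invr {R : realType} :
  measurable_fun [set: R] (@GRing.inv R).
Proof.
rewrite -(setUv [set 0%R : R]); apply/measurable_funU => //.
  exact: measurableC.
split; first exact: measurable_fun_set1.
apply: open_continuous_measurable_fun.
  exact/closed_openC/accessible_closed_set1/hausdorff_accessible/Rhausdorff.
by move=> x /set_mem /= /eqP x0; exact: inv_continuous.
Qed.

Lemma measurable_funV {R : realType} d (T : measurableType d) (f : T -> R) :
  measurable_fun [set: T] f -> measurable_fun [set: T] (fun x => (f x)^-1)%R.
Proof. by move=> mf; exact: measurableT_comp measurable_invr mf. Qed.

Lemma measurable_sin {R : realType} : measurable_fun [set: R] (@sin R).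
Proof. by apply: continuous_measurable_fun; exact: continuous_sin. Qed.

Lemma measurable_cos {R : realType} : measurable_fun [set: R] (@cos R).
Proof. by apply: continuous_measurable_fun; exact: continuous_cos. Qed.

(** * One-dimensional substitutions and Tonelli for Lebesgue measure *)

Section change_of_variables.
Context {R : realType}.
Local Notation mu := (@lebesgue_measure R).
Implicit Types (f : R -> \bar R).

(** The image under [phi] of the measure with density [w] gives each interval []p, q]] its length,
    hence is Lebesgue measure. A substitution thus costs one integral over the preimage of an
    interval. *)
Lemma ge0_integral_substitution (phi w : R -> R) f :
  measurable_fun [set: R] phi -> measurable_fun [set: R] w ->
  (forall x, (0 <= w x)%R) ->
  (forall p q, (p < q)%R -> \int[mu]_(x in phi @^-1` `]p, q]) (w x)%:E = (q - p)%:E) ->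
  measurable_fun [set: R] f -> (forall x, 0 <= f x) ->
  \int[mu]_x (f (phi x) * (w x)%:E) = \int[mu]_x f x.
Proof.
move=> mphi mw w0 phiE mf f0.
have [lam [lamE lamI]] := @density_measure _ (measurableTypeR R) R mu w mw w0.
have [nu [nuE nuI]] := @image_measure _ _ (measurableTypeR R) (measurableTypeR R)
  R lam phi mphi.
rewrite -lamI//; last exact: measurableT_comp.
rewrite -nuI//.
apply: eq_measure_integral => A mA _.
apply/esym/lebesgue_measure_unique => //= _ [[p q]] _ <-.
rewrite nuE lebesgue_measure_itv/= lte_fin.
case: ltP => [pq|qp]; first by rewrite lamE phiE.
rewrite set_itv_ge ?preimage_set0 ?measure0//.
by rewrite bnd_simp -leNgt.
Qed.

Lemma ge0_integral_affine f (a b : R) : a != 0%R ->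
  measurable_fun [set: R] f -> (forall x, 0 <= f x) ->
  \int[mu]_x (f (x * a + b)%R * `|a|%:E) = \int[mu]_x f x.
Proof.
move=> a0 mf f0.
apply: (@ge0_integral_substitution (fun x => x * a + b)%R (fun=> `|a|%R)) => //.
  by apply: measurable_funD => //; exact: measurable_funM.
move=> p q pq; have [agt0|alt0] := ltP 0%R a.
  have -> : (fun x => x * a + b)%R @^-1` `]p, q] =
      `]((p - b) / a)%R, ((q - b) / a)%R]%classic.
    apply/seteqP; split => x /=;
      by rewrite !in_itv/= ltr_pdivrMr// ler_pdivlMr// ltrBlDr lerBrDr.
  rewrite integral_cst// [X in _ * X]lebesgue_measure_itv/= lte_fin.
  rewrite ltr_pM2r ?invr_gt0// ltrD2r pq.
  by rewrite -EFinB -EFinM gtr0_norm//; congr EFin; field.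
have {alt0}alt0 : (a < 0)%R by rewrite lt_neqAle a0.
have -> : (fun x => x * a + b)%R @^-1` `]p, q] =
    `[((q - b) / a)%R, ((p - b) / a)%R[%classic.
  apply/seteqP; split => x /=;
    by rewrite !in_itv/= ltr_ndivlMr// ler_ndivrMr// ltrBlDr lerBrDr andbC.
rewrite integral_cst// [X in _ * X]lebesgue_measure_itv/= lte_fin.
rewrite ltr_nM2r ?invr_lt0// ltrD2r pq.
by rewrite -EFinB -EFinM ltr0_norm//; congr EFin; field.
Qed.

(** [tan] is taken on the whole line with a weight cut off outside one period; the mass of []p, q]]
    is then the integral of the derivative of [tan] between [atan p] and [atan q]. *)
Lemma ge0_integral_tan f :
  measurable_fun [set: R] f -> (forall x, 0 <= f x) ->
  \int[mu]_(t in `](- (pi / 2))%R, (pi / 2)%R[) (f (tan t) * ((cos t) ^- 2)%:E) =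
  \int[mu]_x f x.
Proof.
move=> mf f0.
set I := `](- (pi / 2))%R, (pi / 2)%R[%classic.
have mI : measurable I by exact: measurable_itv.
have mw : measurable_fun [set: R] (fun t : R => (\1_I t * (cos t) ^- 2)%R).
  apply: measurable_funM; first exact: measurable_indic.
  by apply: measurable_funV; apply: measurable_funX; exact: measurable_cos.
have mtan : measurable_fun [set: R] (@tan R).
  apply: measurable_funM; first exact: measurable_sin.
  exact: measurable_funV measurable_cos.
have wge0 (t : R) : (0 <= (cos t) ^- 2)%R by rewrite invr_ge0 sqr_ge0.
transitivity (\int[mu]_t (f (tan t) * (\1_I t * (cos t) ^- 2)%:E)).
  rewrite integral_mkcond; apply: eq_integral => t _.
  by rewrite /patch indicE; case: ifP => _; rewrite ?mul1r// mul0r mule0.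
apply: ge0_integral_substitution => //; first by move=> t; rewrite mulr_ge0.
move=> p q pq.
have pqat : (atan p < atan q)%R by exact: lt_atan.
have sub x : x \in `[atan p, atan q] -> x \in `]- (pi / 2), (pi / 2)[%R.
  rewrite !in_itv/= => /andP[xp xq].
  by rewrite (lt_le_trans (atan_gtNpi2 _) xp) (le_lt_trans xq (atan_ltpi2 _)).
transitivity (\int[mu]_(t in `]atan p, atan q]) ((cos t) ^- 2)%:E).
  rewrite integral_mkcond [RHS]integral_mkcond; apply: eq_integral => t _.
  rewrite /patch; have [tI|tI] := boolP (t \in I); last first.
    have -> : (t \in `]atan p, atan q]%classic) = false.
      apply/negbTE; apply: contra tI; rewrite !inE => tpq.
      by apply: sub; exact: subset_itv_oc_cc tpq.
    by rewrite indicE (negbTE tI) mul0r; case: ifP.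
  rewrite indicE tI mul1r.
  suff -> : (t \in tan @^-1` `]p, q]) = (t \in `]atan p, atan q]%classic) by [].
  have atanI (x : R) : atan x \in `]- (pi / 2), (pi / 2)[%R.
    by rewrite in_itv/= atan_gtNpi2 atan_ltpi2.
  have {}tI : t \in `]- (pi / 2), (pi / 2)[%R by move: tI; rewrite inE.
  have tan_lt (x : R) : (x < tan t)%R = (atan x < t)%R.
    by rewrite -[in LHS](atanK x) (ltr_tan (atanI x) tI).
  apply/idP/idP; rewrite !inE/= !in_itv/= tan_lt => /andP[-> /=].
    by rewrite !leNgt tan_lt.
  by rewrite !leNgt tan_lt.
rewrite integral_itv_obnd_cbnd; last first.
  by apply/measurable_EFinP/measurable_funTS/measurable_funV/measurable_funX;
    exact: measurable_cos.
have cosn0 (x : R) : x \in `[atan p, atan q] -> cos x != 0%R.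
  by move=> /sub; rewrite in_itv/= => /cos_gt0_pihalf; rewrite lt0r => /andP[].
have cw : {within `[atan p, atan q], continuous (fun x : R => (cos x) ^- 2)%R}.
  apply: continuous_in_subspaceT => x /set_mem/= xpq.
  apply: (@continuous_comp R R R (fun y => cos y ^+ 2)%R (@GRing.inv R)).
    apply: (@continuous_comp R R R cos (fun y => y ^+ 2)%R).
      exact: continuous_cos.
    exact: exprn_continuous.
  by apply: inv_continuous; rewrite expf_neq0// cosn0.
rewrite (@continuous_FTC2 _ (fun x : R => (cos x) ^- 2)%R (@tan R) _ _ pqat cw);
  [by rewrite !atanK| |].
- split.
  + by move=> x xpq; apply: derivable_tan; apply: cosn0; exact: subset_itv_oo_cc xpq.
  + apply: cvg_at_right_filter; apply: continuous_tan; apply: cosn0.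
    by rewrite in_itv/= lexx ltW.
  + apply: cvg_at_left_filter; apply: continuous_tan; apply: cosn0.
    by rewrite in_itv/= lexx ltW.
- move=> x xpq; rewrite derive1E.
  have := @is_derive_tan R x; rewrite cosn0 ?(subset_itv_oo_cc xpq)// => /(_ isT).
  by move=> h; rewrite derive_val.
Qed.

Lemma integral_mulr_indic (D : set R) f :
  \int[mu]_(x in D) f x = \int[mu]_x (f x * (\1_D x)%:E).
Proof.
rewrite integral_mkcond; apply: eq_integral => x _.
by rewrite /patch indicE; case: ifP => _; rewrite ?mule1 ?mule0.
Qed.

Lemma measurable_tan : measurable_fun [set: R] (@tan R).
Proof.
apply: measurable_funM; first exact: measurable_sin.
exact: measurable_funV measurable_cos.
Qed.

Lemma measurable_pair_left (F : R * R -> \bar R) (y : R) :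
  measurable_fun [set: R * R] F -> measurable_fun [set: R] (fun x => F (x, y)).
Proof. by move=> mF; apply: measurableT_comp => //; exact: measurable_pair2. Qed.

Lemma measurable_pair_right (F : R * R -> \bar R) (x : R) :
  measurable_fun [set: R * R] F -> measurable_fun [set: R] (fun y => F (x, y)).
Proof. by move=> mF; apply: measurableT_comp => //; exact: measurable_pair1. Qed.

Lemma measurable_partial_integral (F : R * R -> \bar R) :
  measurable_fun [set: R * R] F -> (forall z, 0 <= F z) ->
  measurable_fun [set: R] (fun x => \int[mu]_y F (x, y)).
Proof.
move=> mF F0.
exact: (@measurable_fun_fubini_tonelli_F _ _ (measurableTypeR R)
  (measurableTypeR R) R mu F mF F0).
Qed.

Lemma tonelli_lebesgue (F : R * R -> \bar R) :
  measurable_fun [set: R * R] F -> (forall z, 0 <= F z) ->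
  \int[mu]_x \int[mu]_y F (x, y) = \int[mu]_y \int[mu]_x F (x, y).
Proof.
move=> mF F0.
exact: (@fubini_tonelli _ _ (measurableTypeR R) (measurableTypeR R) R mu mu F mF F0).
Qed.

End change_of_variables.

(** * Polar coordinates and rotations in the plane *)

Section polar.
Context {R : realType}.
Local Notation mu := (@lebesgue_measure R).
Implicit Types (f : R -> \bar R).

(** Two one-dimensional substitutions: x = y tan t at fixed y, then y = r cos t at fixed t. The
    Jacobians |y| / cos(t)^2 and |cos t| multiply to |r|, and t -> pi / 2 - t restores the usual
    angle. Negative [r] contributes nothing: for t in []0, pi[] the point then lies in the lower
    half-plane, where [F] vanishes. *)
Lemma ge0_integral_polar (F : R * R -> \bar R) :
  measurable_fun [set: R * R] F -> (forall z, 0 <= F z) ->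
  (forall x y, (y <= 0)%R -> F (x, y) = 0) ->
  \int[mu]_x \int[mu]_y F (x, y) =
  \int[mu]_(t in `]0%R, pi[) \int[mu]_r (F (r * cos t, r * sin t)%R * `|r|%:E).
Proof.
move=> mF F0 Fneg.
pose I : set R := `](- (pi / 2))%R, (pi / 2)%R[%classic.
have mI : measurable I by exact: measurable_itv.
pose W (z : R * R) :=
  F (tan z.2 * z.1, z.1)%R * (`|z.1| * (cos z.2) ^- 2 * \1_I z.2)%:E.
have W0 z : 0 <= W z.
  by rewrite mule_ge0// lee_fin !mulr_ge0// invr_ge0 sqr_ge0.
have mW : measurable_fun [set: R * R] W.
  apply: emeasurable_funM.
    apply: measurableT_comp => //; apply: measurable_fun_pair => //=.
    by apply: measurable_funM => //; exact: measurableT_comp measurable_tan _.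
  apply/measurable_EFinP; apply: measurable_funM; last first.
    exact: measurableT_comp (measurable_indic mI) _.
  apply: measurable_funM; first exact: measurableT_comp.
  apply: measurable_funV; apply: measurable_funX.
  exact: measurableT_comp measurable_cos _.
rewrite (tonelli_lebesgue mF F0).
transitivity (\int[mu]_y \int[mu]_t W (y, t)).
  apply: eq_integral => y _.
  have [->|y0] := eqVneq y 0%R.
    rewrite integral0_eq; last by move=> x _; rewrite Fneg.
    rewrite integral0_eq// => t _.
    by rewrite /W/= normr0 !mul0r mule0.
  have mFy : measurable_fun [set: R] (fun x => F (x, y)).
    exact: measurable_pair_left.
  rewrite -(ge0_integral_affine (f := fun x => F (x, y)) 0%R y0)//.
  rewrite -(ge0_integral_tan (f := fun x => F (x * y + 0, y)%R * `|y|%:E)).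
  - rewrite integral_mulr_indic; apply: eq_integral => t _.
    by rewrite /W/= addr0 -!muleA -!EFinM mulrA.
  - apply: emeasurable_funM => //.
    apply: (measurableT_comp mFy).
    by apply: measurable_funD => //; exact: measurable_funM.
  - by move=> x; rewrite mule_ge0.
rewrite (tonelli_lebesgue mW W0).
pose V (z : R * R) := F (z.2 * sin z.1, z.2 * cos z.1)%R * `|z.2|%:E.
pose G t := (\int[mu]_r V (t, r)) * (\1_I t)%:E.
have G0 t : 0 <= G t.
  by rewrite mule_ge0 ?lee_fin//; apply: integral_ge0 => r _; rewrite mule_ge0.
have mV : measurable_fun [set: R * R] V.
  apply: emeasurable_funM.
    apply: measurableT_comp => //; apply: measurable_fun_pair => //=.
      by apply: measurable_funM => //; exact: measurableT_comp measurable_sin _.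
    by apply: measurable_funM => //; exact: measurableT_comp measurable_cos _.
  exact/measurable_EFinP/measurableT_comp.
have mG : measurable_fun [set: R] G.
  apply: emeasurable_funM; last exact/measurable_EFinP/measurable_indic.
  apply: measurable_partial_integral => // z.
  by rewrite mule_ge0.
transitivity (\int[mu]_t G t).
  apply: eq_integral => t _; rewrite /G indicE.
  have [tI|tI] := boolP (t \in I); last first.
    rewrite mule0 integral0_eq// => y _.
    by rewrite /W/= indicE (negbTE tI) mulr0 mule0.
  have ct0 : (0 < cos t)%R.
    by move: tI; rewrite /I inE/= in_itv/=; exact: cos_gt0_pihalf.
  rewrite mule1 -(ge0_integral_affine (f := fun y => W (y, t)) 0%R (lt0r_neq0 ct0))//.
    apply: eq_integral => r _; rewrite /W/V/= indicE tI addr0 -muleA -EFinM mulr1.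
    have -> : (tan t * (r * cos t) = r * sin t)%R.
      by rewrite /tan; field; rewrite lt0r_neq0.
    congr (_ * _%:E); rewrite normrM (gtr0_norm ct0); field.
    by rewrite lt0r_neq0.
  exact: measurable_pair_left.
rewrite -(ge0_integral_affine (f := G) (pi / 2)%R (a := (-1)%R)) ?oppr_eq0//.
rewrite [RHS]integral_mulr_indic; apply: eq_integral => t _.
rewrite normrN normr1 mule1 /G mulrN1.
rewrite addrC /V.
have -> : \1_I (pi / 2 - t)%R = \1_(`]0%R, pi[%classic) t :> R.
  rewrite /I !indicE; congr ((nat_of_bool _)%:R); apply/idP/idP; rewrite !inE/= !in_itv/=.
    by move=> /andP[? ?]; apply/andP; split; lra.
  by move=> /andP[? ?]; apply/andP; split; lra.
congr (_ * _); apply: eq_integral => r _.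
by rewrite /= sinB cosB sin_pihalf cos_pihalf !mul1r !mul0r subr0 add0r.
Qed.

(** For c != 0 the rotation is a composition of two affine changes of one variable: u = c x - s y
    replaces x, and the other coordinate becomes (s u + y) / c because c^2 + s^2 = 1. For c = 0 it
    is a swap of the axes up to signs. *)
Lemma ge0_integral_rotation (H : R * R -> \bar R) (c s : R) :
  (c ^+ 2 + s ^+ 2 = 1)%R ->
  measurable_fun [set: R * R] H -> (forall z, 0 <= H z) ->
  \int[mu]_x \int[mu]_y H (c * x - s * y, s * x + c * y)%R =
  \int[mu]_x \int[mu]_y H (x, y).
Proof.
move=> cs1 mH H0.
have [c0|c0] := eqVneq c 0%R.
  have s0 : s != 0%R by apply: contra_eq_neq cs1 => ->; rewrite c0 expr0n/= addr0 eq_sym oner_neq0.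
  have s1 : `|s|%R = 1%R.
    apply/eqP; rewrite -(@eqrXn2 _ 2)// ?normr_ge0// expr1n real_normK ?num_real//.
    by rewrite -cs1 c0 expr0n add0r.
  have mHs x : measurable_fun [set: R] (fun u => H (u, s * x)%R).
    exact: measurable_pair_left.
  transitivity (\int[mu]_x \int[mu]_u H (u, s * x)%R).
    apply: eq_integral => x _.
    rewrite -[RHS](ge0_integral_affine (a := (- s)%R) 0%R) ?oppr_eq0//.
    apply: eq_integral => y _; rewrite normrN s1 mule1 c0 !mul0r sub0r !addr0.
    by rewrite mulrN mulrC.
  rewrite (tonelli_lebesgue (F := fun z => H (z.2, s * z.1)%R))//=; last first.
    apply: measurableT_comp => //; apply: measurable_fun_pair => //=.
    exact: measurable_funM.
  apply: eq_integral => u _.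
  rewrite -[RHS](ge0_integral_affine 0%R s0)//; last exact: measurable_pair_right.
  by apply: eq_integral => x _; rewrite s1 mule1 addr0 mulrC.
rewrite (tonelli_lebesgue
  (F := fun z => H (c * z.1 - s * z.2, s * z.1 + c * z.2)%R))//=; last first.
  apply: measurableT_comp => //; apply: measurable_fun_pair => //=.
    by apply: measurable_funB; exact: measurable_funM.
  by apply: measurable_funD; exact: measurable_funM.
pose K (z : R * R) := H (z.2, (s * z.2 + z.1) / c)%R * `|c^-1|%:E.
have K0 z : 0 <= K z by rewrite mule_ge0.
have mK : measurable_fun [set: R * R] K.
  apply: emeasurable_funM => //.
  apply: measurableT_comp => //; apply: measurable_fun_pair => //=.
  apply: measurable_funM => //; apply: measurable_funD => //.
  exact: measurable_funM.
transitivity (\int[mu]_y \int[mu]_u K (y, u)).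
  apply: eq_integral => y _.
  rewrite -[RHS](ge0_integral_affine (- (s * y))%R c0)//; last first.
    exact: measurable_pair_right.
  apply: eq_integral => x _; rewrite /K/= -muleA -EFinM normfV mulVf ?normr_eq0//.
  rewrite mule1; congr (H (_, _)); first by rewrite mulrC.
  have -> : (s * (x * c - s * y) + y = (s * x * c) + (1 - s ^+ 2) * y)%R by ring.
  by rewrite -cs1; field.
rewrite (tonelli_lebesgue mK K0); apply: eq_integral => u _.
rewrite -[RHS](ge0_integral_affine (s * u / c)%R (a := c^-1%R)) ?invr_eq0//; last first.
  exact: measurable_pair_right.
by apply: eq_integral => y _; rewrite /K/= mulrDl addrC.
Qed.

End polar.

(** * Measurability of the planar norm and angle *)

Section measurability.
Context {R : realType}.

Lemma measurable_acos : measurable_fun `[(-1 : R)%R, 1%R]%classic (@acos R).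
Proof.
have -> : `[(-1 : R)%R, 1%R]%classic = [set (-1)%R : R] `|` `](-1)%R, 1%R[%classic `|` [set 1%R].
  apply/seteqP; split => x /=; rewrite !in_itv/=.
    move=> /andP[]; rewrite le_eqVlt => /predU1P[<-|x1]; first by left; left.
    by rewrite le_eqVlt => /predU1P[->|x2]; [right|left; right; rewrite x1].
  by move=> [[->|/andP[? ?]]|->]; apply/andP; split; lra.
apply/measurable_funU => //; first exact: measurableU.
split; last exact: measurable_fun_set1.
apply/measurable_funU => //; split; first exact: measurable_fun_set1.
apply: open_continuous_measurable_fun => //.
by move=> x; rewrite inE/= in_itv/=; exact: continuous_acos.
Qed.

Lemma measurable_sqrtr : measurable_fun [set: R] (@Num.sqrt R).
Proof. by apply: continuous_measurable_fun; exact: sqrt_continuous. Qed.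

Definition norm2 (z : R * R) := Num.sqrt (z.1 ^+ 2 + z.2 ^+ 2).

Lemma measurable_norm2 : measurable_fun [set: R * R] norm2.
Proof.
apply: (measurableT_comp measurable_sqrtr).
by apply: measurable_funD; exact: measurable_funX.
Qed.

Lemma cos_angle2_itv (z : R * R) : (-1 <= z.1 / norm2 z <= 1)%R.
Proof.
have n_ge0 : (0 <= norm2 z)%R by exact: sqrtr_ge0.
rewrite -ler_norml normrM normfV (ger0_norm n_ge0).
have [->|n0] := eqVneq (norm2 z) 0%R; first by rewrite invr0 mulr0.
rewrite ler_pdivrMr ?mul1r; last by rewrite lt0r n0.
by rewrite -sqrtr_sqr ler_wsqrtr// lerDl sqr_ge0.
Qed.

Lemma measurable_angle2 :
  measurable_fun [set: R * R] (fun z => acos (z.1 / norm2 z)).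
Proof.
apply: (@measurable_comp _ _ _ _ _ _ `[(-1 : R)%R, 1%R]%classic) measurable_acos _ => //.
  by move=> _ [z _ <-] /=; rewrite in_itv/= cos_angle2_itv.
by apply: measurable_funM => //; exact: measurable_funV measurable_norm2.
Qed.

Lemma norm2_polar (r t : R) : (0 < r)%R -> norm2 (r * cos t, r * sin t)%R = r.
Proof.
move=> r0; rewrite /norm2/= !exprMn -mulrDr cos2Dsin2 mulr1 sqrtr_sqr.
by rewrite gtr0_norm.
Qed.

End measurability.

(** * From product laws on rectangles to planar and polar densities *)

Section joint_density.
Context {R : realType}.
Local Notation mu := (@lebesgue_measure R).
Context d (T : measurableType d) (P : probability T R).
Variables (E : set T) (X Y : T -> R) (f1 f2 : R -> R) (c : R).
Hypotheses (mE : measurable E).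
Hypotheses (mX : measurable_fun [set: T] X) (mY : measurable_fun [set: T] Y).
Hypotheses (mf1 : measurable_fun [set: R] f1) (mf2 : measurable_fun [set: R] f2).
Hypotheses (f10 : forall x, (0 <= f1 x)%R) (f20 : forall x, (0 <= f2 x)%R).
Hypothesis c0 : (0 <= c)%R.
Hypothesis rect : forall A B, measurable A -> measurable B ->
  P (E `&` (X @^-1` A `&` Y @^-1` B)) =
  c%:E * (\int[mu]_(x in A) (f1 x)%:E * \int[mu]_(y in B) (f2 y)%:E).

Let f (z : R * R) := (f1 z.1 * f2 z.2)%R.

Let f0 z : (0 <= f z)%R. Proof. by rewrite /f mulr_ge0. Qed.

Let mf : measurable_fun [set: R * R] f.
Proof.
by apply: measurable_funM; [exact: measurableT_comp mf1 _|
  exact: measurableT_comp mf2 _].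
Qed.

(** Both sides are finite measures in [D] that agree on rectangles, a pi-system generating the
    product sigma-algebra. The event [E] carries constraints on the other coordinates, so that the
    result applies to two coordinates inside a longer vector. *)
Lemma joint_density (D : set (R * R)) : measurable D ->
  P (E `&` (fun t => (X t, Y t)) @^-1` D) =
  c%:E * \int[mu]_x \int[mu]_y (\1_D (x, y) * (f1 x * f2 y))%:E.
Proof.
move=> mD.
have mXY : measurable_fun [set: T] (fun t => (X t, Y t)).
  exact: measurable_fun_pair.
have [m1 [m1E _]] := @image_measure _ _ T (measurableTypeR R * measurableTypeR R)%type R (mrestr P mE) _ mXY.
have mcf : measurable_fun [set: R * R] (fun z => c * f z)%R.
  exact: measurable_funM.
have cf0 z : (0 <= c * f z)%R by rewrite mulr_ge0.
have [m2 [m2E _]] := @density_measure _ (measurableTypeR R * measurableTypeR R)%type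
  R (mu \x mu) _ mcf cf0.
have m2E' (B : set (R * R)) : measurable B ->
    m2 B = c%:E * \int[mu]_x \int[mu]_y (\1_B (x, y) * (f1 x * f2 y))%:E.
  move=> mB; rewrite m2E.
  pose h (z : R * R) := (\1_B z * f z)%:E.
  have h0 z : 0 <= h z by rewrite lee_fin mulr_ge0.
  have mh : measurable_fun [set: R * R] h.
    by apply/measurable_EFinP; apply: measurable_funM.
  have -> : \int[mu]_x \int[mu]_y (\1_B (x, y) * (f1 x * f2 y))%:E =
      \int[mu \x mu]_z h z.
    by rewrite (@fubini_tonelli1 _ _ (measurableTypeR R) (measurableTypeR R) R
      mu mu h mh h0).
  rewrite -(ge0_integralZl (mu \x mu) measurableT mh (fun z _ => h0 z))//.
  rewrite integral_mkcond; apply: eq_integral => z _.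
  rewrite /patch /h indicE; case: ifP => _.
    by rewrite mul1r EFinM.
  by rewrite mul0r mule0.
have m1R A B : measurable A -> measurable B -> m1 (A `*` B) = m2 (A `*` B).
  move=> mA mB; rewrite m2E'; last exact: measurableX.
  rewrite m1E /= /mrestr setIC [_ @^-1` _](_ : _ = X @^-1` A `&` Y @^-1` B)//.
  rewrite rect//; congr (_ * _).
  pose F (z : R * R) := (\1_A z.1 * f1 z.1)%:E.
  rewrite -ge0_integralZr//; last 3 first.
    by apply/measurable_funTS/measurable_EFinP.
    by move=> x _; rewrite lee_fin.
    by apply: integral_ge0 => y _; rewrite lee_fin.
  rewrite [LHS]integral_mulr_indic; apply: eq_integral => x _.
  rewrite -muleA [X in _ * X]muleC muleA -EFinM integral_mulr_indic.
  rewrite -ge0_integralZl//; last 3 first.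
    apply: emeasurable_funM; first exact/measurable_EFinP.
    exact/measurable_EFinP/measurable_indic.
    by move=> y _; rewrite mule_ge0// lee_fin.
    by rewrite lee_fin mulr_ge0.
  apply: eq_integral => y _; rewrite -!EFinM; congr EFin.
  rewrite !indicE in_setX/=.
  by case: (_ \in A); case: (_ \in B); rewrite /= ?(mulr0, mul0r, mulr1, mul1r).
transitivity (m1 D); first by rewrite m1E /= /mrestr setIC.
rewrite -m2E'//.
pose C : set (set (measurableTypeR R * measurableTypeR R)) :=
  [set C | exists A, measurable A /\ exists B, measurable B /\ C = A `*` B].
apply: (measure_unique C (fun=> setT)) => //.
- rewrite measurable_prod_measurableType; congr (<<s _ >>).
  rewrite predeqE; split => [[A mA [B mB <-]]|[A [mA [B [mB ->]]]]].
    by exists A; split => //; exists B.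
  by exists A => //; exists B.
- move=> _ _ [A1 [mA1 [A2 [mA2 ->]]]] [B1 [mB1 [B2 [mB2 ->]]]].
  rewrite -setXI; exists (A1 `&` B1); split; first exact: measurableI.
  by exists (A2 `&` B2); split => //; exact: measurableI.
- by move=> _; exists setT; split=> //; exists setT; split=> //; rewrite setXTT.
- by rewrite bigcup_const//; exists 0%N.
- by move=> _ [A [mA [B [mB ->]]]]; exact: m1R.
- move=> _; rewrite m1E /= /mrestr.
  rewrite (le_lt_trans (probability_le1 P _)) ?ltry//.
  by apply: measurableI => //; rewrite preimage_setT.
Qed.

Hypothesis f2neg : forall y, (y <= 0)%R -> f2 y = 0%R.

Let H (r t : R) := (f1 (r * cos t) * f2 (r * sin t) * r)%R.

Let H0 r t : (0 <= t <= pi)%R -> (0 <= H r t)%R.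
Proof.
move=> t0pi; have [r0|r0] := ltP 0%R r; first by rewrite mulr_ge0// ?mulr_ge0// ltW.
rewrite /H f2neg ?mulr0 ?mul0r//.
by rewrite mulr_le0_ge0// sin_ge0_pi.
Qed.

Lemma joint_density_polar (A B : set R) : measurable A -> measurable B ->
  A `<=` `[0%R, pi]%classic ->
  P (E `&` (fun t => acos (X t / norm2 (X t, Y t))) @^-1` A
       `&` (fun t => norm2 (X t, Y t)) @^-1` B) =
  c%:E * \int[mu]_(r in B) \int[mu]_(t in A) (H r t)%:E.
Proof.
move=> mA mB A0pi.
pose D : set (R * R) := (fun z => acos (z.1 / norm2 z)) @^-1` A `&` norm2 @^-1` B.
have mD : measurable D.
  apply: measurableI.
    by rewrite -[X in measurable X]setTI; exact: measurable_angle2.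
  by rewrite -[X in measurable X]setTI; exact: measurable_norm2.
rewrite -setIA; have := joint_density mD; rewrite /D preimage_setI => ->.
rewrite -/D; congr (_ * _).
pose F (z : R * R) := (\1_D z * (f1 z.1 * f2 z.2))%:E.
have F0 z : 0 <= F z by rewrite lee_fin mulr_ge0// mulr_ge0.
have mF : measurable_fun [set: R * R] F.
  by apply/measurable_EFinP; apply: measurable_funM.
have Fneg x y : (y <= 0)%R -> F (x, y) = 0.
  by move=> y0; rewrite /F/= f2neg// !mulr0.
transitivity (\int[mu]_(t in `]0%R, pi[)
    \int[mu]_r (F (r * cos t, r * sin t)%R * `|r|%:E)).
  exact: ge0_integral_polar mF F0 Fneg.
pose W (z : R * R) := (\1_A z.1 * \1_B z.2 * (f1 (z.2 * cos z.1) *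
  f2 (z.2 * sin z.1) * `|z.2|))%:E.
have W0 z : 0 <= W z by rewrite lee_fin !mulr_ge0.
have mW : measurable_fun [set: R * R] W.
  have mcos : measurable_fun [set: R * R] (fun z => z.2 * cos z.1)%R.
    by apply: measurable_funM => //; exact: measurableT_comp measurable_cos _.
  have msin : measurable_fun [set: R * R] (fun z => z.2 * sin z.1)%R.
    by apply: measurable_funM => //; exact: measurableT_comp measurable_sin _.
  apply/measurable_EFinP; apply: measurable_funM.
    by apply: measurable_funM; exact: measurableT_comp (measurable_indic _) _.
  apply: measurable_funM; last exact: measurableT_comp.
  apply: measurable_funM.
    exact: measurableT_comp mf1 mcos.
  exact: measurableT_comp mf2 msin.
transitivity (\int[mu]_t \int[mu]_r W (t, r)).
  rewrite integral_mkcond; apply: eq_integral => t _; rewrite /patch.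
  case: ifPn => [|tn]; last first.
    apply/esym/integral0_eq => r _; rewrite /W/= indicE.
    have [/set_mem/A0pi/=|] := boolP (t \in A); last by rewrite !mul0r.
    rewrite in_itv/= => tpi.
    (* The polar formula integrates over []0, pi[], whereas [A] may contain 0 and pi; there [f2] is
       evaluated at 0, where it vanishes. *)
    suff -> : sin t = 0%R by rewrite mulr0 f2neg// !(mulr0, mul0r).
    have : ~~ (0 < t < pi)%R by apply: contra tn; rewrite inE/= in_itv.
    rewrite negb_and -!leNgt; case/andP : tpi => t0 tpi /orP[t0'|tpi'].
      have -> : t = 0%R by apply/eqP; rewrite eq_le t0 t0'.
      exact: sin0.
    have -> : t = pi by apply/eqP; rewrite eq_le tpi tpi'.
    exact: sinpi.
  rewrite inE/= in_itv/= => tpi; have st : (0 < sin t)%R by exact: sin_gt0_pi.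
  apply: eq_integral => r _; rewrite /F/W/= -EFinM; congr EFin.
  have [r0|r0] := ltP 0%R r; last first.
    by rewrite f2neg ?mulr0 ?mul0r ?mulr0// pmulr_lle0.
  rewrite -[LHS]mulrA; congr (_ * _)%R.
  rewrite !indicE /D in_setI.
  have -> : ((r * cos t)%R, (r * sin t)%R) \in norm2 @^-1` B = (r \in B).
    by apply/idP/idP; rewrite !inE /preimage/= norm2_polar.
  have -> : ((r * cos t)%R, (r * sin t)%R) \in
      (fun z : R * R => acos (z.1 / norm2 z)) @^-1` A = (t \in A).
    apply/idP/idP; rewrite !inE /preimage/= norm2_polar// mulrAC divff ?lt0r_neq0//;
    by rewrite mul1r cosK// in_itv/=; case/andP : tpi => /ltW-> /ltW->.
  by case: (t \in A); case: (r \in B); rewrite /= ?mulr1 ?mulr0 ?mul0r.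
rewrite (tonelli_lebesgue mW W0) [RHS]integral_mulr_indic.
apply: eq_integral => r _; rewrite [X in _ = X * _]integral_mulr_indic.
rewrite -ge0_integralZr//; last 2 first.
  apply: emeasurable_funM; last exact/measurable_EFinP/measurable_indic.
  apply/measurable_EFinP; apply: measurable_funM => //; apply: measurable_funM.
    apply: (measurableT_comp mf1); apply: measurable_funM => //.
    exact: measurable_cos.
  apply: (measurableT_comp mf2); apply: measurable_funM => //.
  exact: measurable_sin.
  move=> t _; rewrite indicE; have [/set_mem/A0pi/=|_] := boolP (t \in A).
    by rewrite in_itv/= mule1 lee_fin; exact: H0.
  by rewrite mule0.
apply: eq_integral => t _; rewrite /W/= -!EFinM; congr EFin.
rewrite /H !indicE.
have [/set_mem/A0pi/=|] := boolP (t \in A); last by rewrite !(mulr0, mul0r).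
rewrite in_itv/= mul1r mulr1 mulrC => tpi; congr (_ * _)%R.
have [r0|r0] := leP 0%R r; first by rewrite ger0_norm.
by rewrite f2neg ?mulr0 ?mul0r// mulr_le0_ge0 ?sin_ge0_pi// ltW.
Qed.

Lemma density_norm2 (rho : R -> R) :
  (forall r, (r <= 0)%R -> rho r = 0%R) ->
  (forall r, (0 < r)%R -> \int[mu]_(t in `[0%R, pi]) (H r t)%:E = (rho r)%:E) ->
  forall B, measurable B ->
  P (E `&` (fun t => norm2 (X t, Y t)) @^-1` B) = c%:E * \int[mu]_(r in B) (rho r)%:E.
Proof.
move=> rho0 rhoE B mB.
have := @joint_density_polar `[0%R, pi]%classic B (measurable_itv _) mB (fun _ => id).
have -> : E `&` (fun t => acos (X t / norm2 (X t, Y t))) @^-1` `[0%R, pi]%classic = E.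
  rewrite setIidl// => t _ /=; have := cos_angle2_itv (X t, Y t).
  by move=> h; rewrite in_itv/= acos_ge0// acos_lepi.
move=> ->; congr (_ * _); apply: eq_integral => r _.
have [r0|r0] := ltP 0%R r; first exact: rhoE.
rewrite rho0// integral0_eq// => t /=; rewrite in_itv/= => tpi.
by rewrite /H f2neg ?mulr0 ?mul0r// mulr_le0_ge0// sin_ge0_pi.
Qed.

End joint_density.

End ereal_valued_integrals.

(** * Integrals over [0, pi] and continuity rules *)

Section integral_0pi.
Context {R : realType}.
Local Notation mu := (@lebesgue_measure R).
Implicit Types f : R -> R.

Lemma integrable_0pi f : continuous f -> mu.-integrable `[0, pi] (EFin \o f).
Proof.
move=> cf; apply: continuous_compact_integrable; first exact: segment_compact.
exact: continuous_subspaceT.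
Qed.

Lemma EFin_Rintegral_0pi f : continuous f ->
  (\int[mu]_(t in `[0%R, pi]) (f t)%:E)%E = (\int[mu]_(t in `[0, pi]) f t)%:E.
Proof.
move=> cf; rewrite /Rintegral fineK//.
by apply: integrable_fin_num => //; exact: integrable_0pi.
Qed.

Lemma Rintegral_0pi_ge f (a b c : R) : continuous f ->
  (forall t, 0 <= t <= pi -> 0 <= f t) ->
  0 <= a -> a <= b -> b <= pi -> 0 <= c -> (forall t, a <= t <= b -> c <= f t) ->
  c * (b - a) <= \int[mu]_(t in `[0, pi]) f t.
Proof.
move=> cf f0 a0 ab bpi c0 cf'.
rewrite -lee_fin -EFin_Rintegral_0pi//.
have mf : measurable_fun [set: R] (EFin \o f).
  by apply/measurable_EFinP; exact: continuous_measurable_fun.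
have sub : `[a, b] `<=` `[0, pi].
  by apply: subset_itvScc; rewrite bnd_simp.
apply: (@le_trans _ _ (\int[mu]_(t in `[a, b]) (f t)%:E)%E); last first.
  by apply: ge0_subset_integral => //; exact: measurable_funTS.
apply: (@le_trans _ _ (\int[mu]_(t in `[a, b]) c%:E)%E).
  rewrite integral_cst//= lebesgue_measure_itv/= lte_fin.
  have [->|ab'] := eqVneq a b; first by rewrite ltxx subrr mulr0 mule0.
  by rewrite lt_neqAle ab' ab/= -EFinB -EFinM.
by apply: ge0_le_integral => //; exact: measurable_funTS.
Qed.

Lemma Rintegral_0pi_gt0 f : continuous f ->
  (forall t, 0 <= t <= pi -> 0 <= f t) -> (forall t, 0 < t < pi -> 0 < f t) ->
  0 < \int[mu]_(t in `[0, pi]) f t.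
Proof.
move=> cf f0 fgt0; have pi2 := @pi_ge2 R.
(* As pi >= 2, the interval [1, 3/2] lies inside []0, pi[]; a positive minimum there bounds the
   integral from below. *)
have [c cI cmin] : exists2 c, c \in `[1 : R, 3 / 2]%R &
    forall t, t \in `[1 : R, 3 / 2]%R -> f c <= f t.
  by apply: EVT_min; [lra|exact: continuous_subspaceT].
have fc0 : 0 < f c by apply: fgt0; move: cI; rewrite in_itv/= => /andP[? ?]; lra.
apply: (@lt_le_trans _ _ (f c * (3 / 2 - 1))); first by rewrite mulr_gt0//; lra.
apply: Rintegral_0pi_ge => //; rewrite ?(ltW fc0)//; try lra.
Qed.

Lemma Rintegral_0pi_reflect f : continuous f ->
  (forall t, 0 <= t <= pi -> 0 <= f t) ->
  \int[mu]_(t in `[0, pi]) f (pi - t) = \int[mu]_(t in `[0, pi]) f t.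
Proof.
move=> cf f0; rewrite /Rintegral; congr fine.
pose g (t : R) : \bar R := ((f t)%:E * (\1_(`[0, pi]%classic) t)%:E)%E.
have g0 t : (0 <= g t)%E.
  rewrite /g indicE; case: (boolP (t \in _)); last by rewrite mule0.
  by rewrite inE/= in_itv/= => /f0 ft; rewrite mule1 lee_fin.
have mg : measurable_fun [set: R] g.
  apply: emeasurable_funM; apply/measurable_EFinP => //.
  exact: continuous_measurable_fun.
have N10 : (-1 : R) != 0 by rewrite oppr_eq0 oner_eq0.
rewrite [LHS]integral_mulr_indic [RHS]integral_mulr_indic.
rewrite -[RHS](ge0_integral_affine pi N10 mg g0).
apply: eq_integral => t _; rewrite normrN normr1 mule1 /g.
have -> : t * -1 + pi = pi - t by ring.
congr (_ * _%:E)%E; rewrite !indicE; congr ((nat_of_bool _)%:R).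
by apply/idP/idP; rewrite !inE/= !in_itv/= => /andP[? ?]; apply/andP; split; lra.
Qed.

Lemma continuous_pair_slice (r : R) :
  continuous (fun t : R => (r, t)) /\ continuous (fun t : R => (t, r)).
Proof.
split=> t.
  apply: (@cvg_pair R R R (nbhs t) (nbhs r) (nbhs t) _ _ _ (fun=> r) id).
    exact: cvg_cst.
  exact: cvg_id.
apply: (@cvg_pair R R R (nbhs t) (nbhs t) (nbhs r) _ _ _ id (fun=> r)).
  exact: cvg_id.
exact: cvg_cst.
Qed.

(** Dominated convergence near [r0]: the dominating constant is the maximum of |H| on the compact
    rectangle [r0 - 1, r0 + 1] x [0, pi]. *)
Lemma continuous_Rintegral_0pi (H : R * R -> R) : continuous H ->
  continuous (fun r => \int[mu]_(t in `[0, pi]) H (r, t)).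
Proof.
move=> cH r0.
have cHr r : continuous (fun t => H (r, t)).
  move=> t; apply: (continuous_comp _ (cH (r, t))).
  exact: (continuous_pair_slice r).1.
have cHt t : continuous (fun r => H (r, t)).
  move=> r; apply: (continuous_comp _ (cH (r, t))).
  exact: (continuous_pair_slice t).2.
pose A : set (R * R) := `[r0 - 1, r0 + 1]%classic `*` `[0, pi]%classic.
have cA : compact A by apply: compact_setX; exact: segment_compact.
have A0 : A !=set0.
  by exists (r0, 0); split; rewrite /= in_itv/= ?lexx ?pi_ge0//; apply/andP; split; lra.
have cHn : continuous (fun z => `|H z|).
  move=> z; apply: (continuous_comp (f := H)); first exact: cH.
  exact: norm_continuous.
have [zm zmA zmax] := compact_EVT_max A0 cA (continuous_subspaceT cHn).
have mI : measurable (`[0, pi]%classic : set R) by exact: measurable_itv.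
have := @continuity_under_integral R _ _ mu (fun r t => H (r, t)) `[0, pi]%classic mI
  (r0 - 1) (r0 + 1) _ _ (fun=> `|H zm|) _ _ r0 _.
apply.
- by move=> r _; exact: integrable_0pi.
- by apply: aeW => t _ r _; exact: cHt.
- by apply: integrable_0pi => t; exact: cvg_cst.
- move=> r /=; rewrite in_itv/= => rr; apply: aeW => t tI; apply: zmax.
  rewrite inE; split=> //=; rewrite in_itv/=.
  by case/andP : rr => /ltW-> /ltW->.
- by rewrite inE/= in_itv/=; apply/andP; split; lra.
Qed.

End integral_0pi.

Section continuity_rules.
Context {R : realType} {T : topologicalType}.
Implicit Types f g : T -> R.

Lemma continuous_fM f g : continuous f -> continuous g -> continuous (fun x => f x * g x).
Proof. by move=> cf cg x; apply: cvgM; [exact: cf|exact: cg]. Qed.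

Lemma continuous_fcomp f (h : R -> R) : continuous f -> continuous h ->
  continuous (fun x => h (f x)).
Proof. by move=> cf ch x; exact: (@continuous_comp T R R f h x (cf x) (ch (f x))). Qed.

Lemma continuous_fX f n : continuous f -> continuous (fun x => f x ^+ n).
Proof. by move=> cf; exact: (continuous_fcomp (h := fun y => y ^+ n) cf (@exprn_continuous R n)). Qed.

End continuity_rules.

Section plane_continuity.
Context {R : realType}.

Lemma continuous_p1 : continuous (fun z : R * R => z.1).
Proof. by move=> z; exact: cvg_fst. Qed.

Lemma continuous_p2 : continuous (fun z : R * R => z.2).
Proof. by move=> z; exact: cvg_snd. Qed.

End plane_continuity.

(** * The spherical exponential integral and its tangent exponentials *)

Section axial_factor.
Context {R : realType}.
Local Notation mu := (@lebesgue_measure R).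
Implicit Types (c : R) (n e : nat).

(* What the peak estimate needs of the log-convexity of [J]: a tangent exponential
   minorant with slope in [-1, 1] at every point. *)
Definition log_tilted (J : R -> R) := [/\ continuous J, forall c, 0 < J c,
  forall c, J (- c) = J c &
  forall c, exists k, `|k| <= 1 /\ forall c', J c * expR (k * (c' - c)) <= J c'].

(** An even [J] cannot have a negative slope at c > 0, as the minorant evaluated at -c would exceed
    [J c]. At c = 0 the slope 0 works: whatever the sign of k, the minorant is at least [J 0] at c'
    or at -c', where [J] takes the same value. *)
Lemma log_tilted_ge0 J c : log_tilted J -> 0 <= c ->
  exists k, 0 <= k <= 1 /\ forall c', J c * expR (k * (c' - c)) <= J c'.
Proof.
move=> [_ J0 JN Jt] c0; have [k [k1 kJ]] := Jt c.
move: c0; rewrite le_eqVlt => /predU1P[c0|c0]; last first.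
  exists k; split=> //; rewrite (le_trans (ler_norm _) k1) andbT.
  have := kJ (- c); rewrite JN -[leRHS]mulr1 ler_pM2l// -[leRHS]expR0 ler_expR.
  by rewrite -opprD mulrN oppr_le0 pmulr_lge0// addr_gt0.
exists 0; rewrite lexx ler01; split=> // c'; rewrite mul0r expR0 mulr1 -c0.
move: kJ; rewrite -c0 => kJ.
have [kc|kc] := leP 0 (k * c').
  by apply: le_trans (kJ c'); rewrite subr0 ler_peMr ?(ltW (J0 _))// -expR0 ler_expR.
rewrite -[leRHS]JN; apply: le_trans (kJ _); rewrite subr0 ler_peMr ?(ltW (J0 _))// -expR0.
by rewrite ler_expR mulrN oppr_ge0 ltW.
Qed.

Definition axial_integrand e (z : R * R) : R := expR (z.1 * cos z.2) * sin z.2 ^+ e.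

(* Up to a constant factor, the integral of [exp (c u_0)] over the unit sphere of
   R^(n+1), which is {-1, 1} when [n = 0]. *)
Definition axial_factor n c : R :=
  if n is e.+1 then \int[mu]_(t in `[0, pi]) axial_integrand e (c, t)
  else expR c + expR (- c).

Lemma continuous_axial_integrand e : continuous (axial_integrand e).
Proof.
apply: continuous_fM.
  apply: (continuous_fcomp _ (@continuous_expR R)).
  apply: continuous_fM; first exact: continuous_p1.
  exact: (continuous_fcomp continuous_p2 (@continuous_cos R)).
exact/continuous_fX/(continuous_fcomp continuous_p2 (@continuous_sin R)).
Qed.

Lemma continuous_axial_slice e c : continuous (fun t => axial_integrand e (c, t)).
Proof.
move=> t; apply: (continuous_comp ((continuous_pair_slice c).1 t)).
exact: continuous_axial_integrand.
Qed.

Lemma axial_integrand_ge0 e c t : 0 <= t <= pi -> 0 <= axial_integrand e (c, t).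
Proof. by move=> tpi; rewrite mulr_ge0 ?expR_ge0// exprn_ge0// sin_ge0_pi. Qed.

(** This is exp(y) >= 1 + y at y = (c' - c)(x - k). Averaged over x, the linear term disappears when
    k is the mean of x under the weight exp(c x); what remains is the tangent exponential. *)
Lemma expR_tilt_ge (k c c' x : R) :
  expR (k * (c' - c)) * (expR (c * x) * (1 + (c' - c) * (x - k))) <= expR (c' * x).
Proof.
have -> : c' * x = k * (c' - c) + (c * x + (c' - c) * (x - k)) by ring.
by rewrite !expRD !ler_pM2l ?expR_gt0// expR_ge1Dx.
Qed.

Lemma log_tilted_axial_factor0 : log_tilted (axial_factor 0).
Proof.
split=> /=.
- move=> c; apply: cvgD; first exact: continuous_expR.
  by apply: (continuous_fcomp (h := expR)); [exact: opp_continuous|exact: continuous_expR].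
- by move=> c; rewrite addr_gt0 ?expR_gt0.
- by move=> c; rewrite opprK addrC.
move=> c; set J := expR c + expR (- c).
have J0 : 0 < J by rewrite addr_gt0 ?expR_gt0.
(* The mean of x over {-1, 1} with weights exp(c x), that is, the hyperbolic tangent of c. *)
exists ((expR c - expR (- c)) / J); set k := _ / J; split.
  rewrite normrM normfV (gtr0_norm J0) ler_pdivrMr// mul1r.
  by rewrite (le_trans (ler_normB _ _))// !gtr0_norm ?expR_gt0.
move=> c'; have := lerD (expR_tilt_ge k c c' 1) (expR_tilt_ge k c c' (-1)).
rewrite !mulr1 !mulrN1; apply: le_trans; rewrite -mulrDr mulrC ler_pM2l ?expR_gt0//.
rewrite le_eqVlt; apply/orP; left; apply/eqP.
have kJ : k * J = expR c - expR (- c) by rewrite divfK// gt_eqF.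
transitivity (J + (c' - c) * (expR c - expR (- c) - k * J)).
  by rewrite kJ subrr mulr0 addr0.
by rewrite /J; ring.
Qed.

Lemma log_tilted_axial_factorS e : log_tilted (axial_factor e.+1).
Proof.
have cf c := @continuous_axial_slice e c.
split=> /=.
- by apply: continuous_Rintegral_0pi; exact: continuous_axial_integrand.
- move=> c; apply: Rintegral_0pi_gt0 => //; first by move=> t; exact: axial_integrand_ge0.
  by move=> t tpi; rewrite mulr_gt0 ?expR_gt0// exprn_gt0// sin_gt0_pi.
- move=> c; rewrite -Rintegral_0pi_reflect//; last by move=> t; exact: axial_integrand_ge0.
  apply: eq_Rintegral => t _; rewrite /axial_integrand/= sinB cosB cospi sinpi.
  congr (expR _ * _ ^+ _); ring.
move=> c; set f := fun t => axial_integrand e (c, t).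
pose g t := cos t * f t.
have cg : continuous g by apply: continuous_fM; [exact: continuous_cos|exact: cf].
set J := \int[mu]_(t in `[0, pi]) f t.
have J0 : 0 < J.
  apply: Rintegral_0pi_gt0; [exact: cf| |]; first by move=> t; exact: axial_integrand_ge0.
  by move=> t tpi; rewrite mulr_gt0 ?expR_gt0// exprn_gt0// sin_gt0_pi.
pose M := \int[mu]_(t in `[0, pi]) g t.
have MJ : `|M| <= J.
  apply: le_trans (le_normr_Rintegral _ (integrable_0pi cg)) _ => //.
  apply: le_Rintegral => //.
  - by apply: integrable_0pi; apply: (continuous_fcomp cg); exact: norm_continuous.
  - exact/integrable_0pi/cf.
  - move=> t; rewrite /= in_itv/= => tpi; rewrite normrM.
    rewrite (ger0_norm (axial_integrand_ge0 _ _ tpi)) ler_piMl//.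
      exact: axial_integrand_ge0.
    exact: cos_max.
(* The mean of [cos] under the normalised [f]; it has absolute value at most 1 because [cos]
   does. *)
exists (M / J); set k := M / J; split.
  by rewrite normrM normfV (gtr0_norm J0) ler_pdivrMr// mul1r.
move=> c'; set d := c' - c.
have cZ a (h : R -> R) : continuous h -> continuous (fun t => a * h t).
  by move=> ch; apply: continuous_fM; [move=> x; exact: cvg_cst|].
have -> : J * expR (k * d) = \int[mu]_(t in `[0, pi])
    (expR (k * d) * (1 - d * k) * f t + expR (k * d) * d * g t).
  rewrite RintegralD//; [|exact/integrable_0pi/cZ/cf|exact/integrable_0pi/cZ/cg].
  rewrite !RintegralZl//; [|exact/integrable_0pi/cg|exact/integrable_0pi/cf].
  rewrite -/J -/M; have -> : M = k * J by rewrite divfK// gt_eqF.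
  ring.
apply: le_Rintegral => //.
- apply: integrable_0pi => t; apply: cvgD; apply: cZ; [exact: cf|exact: cg].
- exact/integrable_0pi/cf.
move=> t; rewrite /= in_itv/= => tpi.
have st : 0 <= sin t ^+ e by rewrite exprn_ge0// sin_ge0_pi.
apply: le_trans (ler_wpM2r st (expR_tilt_ge k c c' (cos t))).
rewrite le_eqVlt; apply/orP; left; apply/eqP.
by rewrite /g /f /axial_integrand/= -/d; ring.
Qed.

Lemma log_tilted_axial_factor n : log_tilted (axial_factor n).
Proof.
by case: n => [|e]; [exact: log_tilted_axial_factor0|exact: log_tilted_axial_factorS].
Qed.

End axial_factor.

(** * Rotation invariance of the isotropic Gaussian law *)

Section product_density.
Context {R : realType}.
Local Notation mu := (@lebesgue_measure R).

Lemma ge0_integral_prod (a b : R -> R) (A B : set R) :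
  measurable A -> measurable B ->
  measurable_fun [set: R] a -> measurable_fun [set: R] b ->
  (forall x, 0 <= a x) -> (forall x, 0 <= b x) ->
  (\int[mu]_x \int[mu]_y ((\1_A x * a x) * (\1_B y * b y))%:E =
   \int[mu]_(x in A) (a x)%:E * \int[mu]_(y in B) (b y)%:E)%E.
Proof.
move=> mA mB ma mb a0 b0.
have ind (D : set R) (f : R -> R) (x : R) :
    ((\1_D x * f x)%:E = (f x)%:E * (\1_D x)%:E)%E by rewrite -EFinM mulrC.
rewrite [X in _ = (X * _)%E]integral_mulr_indic.
rewrite [X in _ = (_ * X)%E]integral_mulr_indic.
under [X in _ = (X * _)%E]eq_integral do rewrite -ind.
under [X in _ = (_ * X)%E]eq_integral do rewrite -ind.
rewrite -ge0_integralZr//; last 3 first.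
  by apply/measurable_EFinP; exact: measurable_funM.
  by move=> x _; rewrite lee_fin mulr_ge0.
  by apply: integral_ge0 => y _; rewrite lee_fin mulr_ge0.
apply: eq_integral => x _; rewrite -ge0_integralZl//.
  by apply/measurable_EFinP; exact: measurable_funM.
  by move=> y _; rewrite lee_fin mulr_ge0.
by rewrite lee_fin mulr_ge0.
Qed.

Lemma normal_pdf_rotation (sigma c s m1 m2 x y : R) :
  sigma != 0 -> c ^+ 2 + s ^+ 2 = 1 ->
  normal_pdf (c * m1 + s * m2) sigma (c * x + s * y) *
    normal_pdf (c * m2 - s * m1) sigma (c * y - s * x) =
  normal_pdf m1 sigma x * normal_pdf m2 sigma y.
Proof.
move=> s0 cs1; rewrite !normal_pdfE// mulrACA [RHS]mulrACA; congr (_ * _).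
rewrite /normal_fun -[LHS]expRD -[RHS]expRD; congr expR.
rewrite -[LHS]mulrDl -[RHS]mulrDl; congr (_ / _).
have -> : c * x + s * y - (c * m1 + s * m2) = c * (x - m1) + s * (y - m2) by ring.
have -> : c * y - s * x - (c * m2 - s * m1) = c * (y - m2) - s * (x - m1) by ring.
set a := x - m1; set b := y - m2.
transitivity (- ((c ^+ 2 + s ^+ 2) * (a ^+ 2 + b ^+ 2))); first by ring.
by rewrite cs1; ring.
Qed.

End product_density.

Section rotations.
Context {R : realType} {d : nat}.
Implicit Types (u w m : 'rV[R]_d) (i k j : 'I_d) (c s : R).
Local Notation mu := (@lebesgue_measure R).

Definition givens i k c s u : 'rV[R]_d :=
  \row_j (if j == i then c * u ord0 i + s * u ord0 k
          else if j == k then c * u ord0 k - s * u ord0 i else u ord0 j).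

Lemma dotv_givens i k c s u w : i != k -> c ^+ 2 + s ^+ 2 = 1 ->
  dotv (givens i k c s u) (givens i k c s w) = dotv u w.
Proof.
move=> ik cs1; rewrite /dotv.
rewrite (bigD1 i)//= (bigD1 k) 1?eq_sym//= [RHS](bigD1 i)//= [in RHS](bigD1 k) 1?eq_sym//=.
rewrite !mxE !eqxx eq_sym (negbTE ik) !addrA; congr (_ + _); last first.
  by apply: eq_bigr => j /andP[ji jk]; rewrite !mxE (negbTE ji) (negbTE jk).
set a := u ord0 i; set b := u ord0 k; set a' := w ord0 i; set b' := w ord0 k.
transitivity ((c ^+ 2 + s ^+ 2) * (a * a' + b * b')); first by ring.
by rewrite cs1 mul1r.
Qed.

Context disp (T : measurableType disp) (P : probability T R).

Lemma isotropic_gaussian_pair i k m (sigma : R) (z : T -> 'rV[R]_d)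
    (A : 'I_d -> set R) (B C : set R) : i != k ->
  isotropic_gaussian P m sigma z ->
  (forall j, measurable (A j)) -> measurable B -> measurable C ->
  P ([set t | forall j, j != i -> j != k -> A j (z t ord0 j)] `&`
     ((fun t => z t ord0 i) @^-1` B `&` (fun t => z t ord0 k) @^-1` C)) =
  (\prod_(j < d | (j != i) && (j != k)) normal_prob (m ord0 j) sigma (A j) *
   (normal_prob (m ord0 i) sigma B * normal_prob (m ord0 k) sigma C))%E.
Proof.
move=> ik [mz zP] mA mB mC.
pose A' j := if j == i then B else if j == k then C else A j.
have mA' j : measurable (A' j) by rewrite /A'; case: ifP => //; case: ifP.
transitivity (P [set t | forall j, A' j (z t ord0 j)]).
  congr (P _); apply/seteqP; split => t /=.
    move=> [At [Bt Ct]] j; rewrite /A'; case: eqVneq => [->//|ji].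
    by case: eqVneq => [->//|jk]; exact: At.
  move=> At; split; last first.
    split; first by have := At i; rewrite /A' eqxx.
    by have := At k; rewrite /A' eq_sym (negbTE ik) eqxx.
  by move=> j ji jk; have := At j; rewrite /A' (negbTE ji) (negbTE jk).
rewrite zP// (bigD1 i)//= (bigD1 k) 1?eq_sym//= muleA muleC.
rewrite /A' !eqxx eq_sym (negbTE ik); congr (_ * _)%E.
by apply: eq_bigr => j /andP[ji jk]; rewrite (negbTE ji) (negbTE jk).
Qed.

(** A box in the rotated coordinates is not a box in the original ones, so the hypothesis on [z]
    does not apply to it directly. [joint_density] extends the law of coordinates i and k to the
    tilted set [D], with the others frozen in [E]; rotating the plane back makes the density a
    product again. *)
Lemma isotropic_gaussian_givens i k c s m (sigma : R) (z : T -> 'rV[R]_d) :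
  i != k -> c ^+ 2 + s ^+ 2 = 1 -> sigma != 0 ->
  isotropic_gaussian P m sigma z ->
  isotropic_gaussian P (givens i k c s m) sigma (fun t => givens i k c s (z t)).
Proof.
move=> ik cs1 sigma0 zP; have mz := zP.1; split.
  move=> j; under eq_fun do rewrite mxE; case: eqVneq => _.
    by apply: measurable_funD; exact: measurable_funM.
  case: eqVneq => _; last exact: mz.
  by apply: measurable_funB; exact: measurable_funM.
move=> A mA.
pose E := [set t | forall j, j != i -> j != k -> A j (z t ord0 j)].
have mE : measurable E.
  have -> : E = \bigcap_(j in [set j | (j != i) && (j != k)])
      (fun t => z t ord0 j) @^-1` A j.
    apply/seteqP; split => t /=.
      by move=> At j /= /andP[ji jk]; exact: At.
    by move=> At j ji jk; apply: At; rewrite /= ji jk.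
  apply: fin_bigcap_measurable => //; first exact: finite_finset.
  by move=> j _; rewrite -[X in measurable X]setTI; exact: mz.
pose D : set (R * R) := [set w | A i (c * w.1 + s * w.2) /\ A k (c * w.2 - s * w.1)].
have mD : measurable D.
  apply: measurableI.
    rewrite -[X in measurable X]setTI.
    apply: (_ : measurable_fun setT (fun w : R * R => c * w.1 + s * w.2)) => //.
    by apply: measurable_funD; exact: measurable_funM.
  rewrite -[X in measurable X]setTI.
  apply: (_ : measurable_fun setT (fun w : R * R => c * w.2 - s * w.1)) => //.
  by apply: measurable_funB; exact: measurable_funM.
pose Q := (\prod_(j < d | (j != i) && (j != k)) normal_prob (m ord0 j) sigma (A j))%E.
have Q0 : (0 <= Q)%E by apply: prode_ge0 => j _; exact: measure_ge0.
have Qfin : Q \is a fin_num.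
  by apply: prode_fin_num => j _; apply: fin_num_measure; exact: mA.
pose g a x := normal_pdf a sigma x.
have rect B C : measurable B -> measurable C ->
    P (E `&` ((fun t => z t ord0 i) @^-1` B `&` (fun t => z t ord0 k) @^-1` C)) =
    ((fine Q)%:E * (\int[mu]_(x in B) (g (m ord0 i) x)%:E *
                    \int[mu]_(x in C) (g (m ord0 k) x)%:E))%E.
  by move=> mB mC; rewrite (isotropic_gaussian_pair ik zP)// fineK.
transitivity (P (E `&` (fun t => (z t ord0 i, z t ord0 k)) @^-1` D)).
  congr (P _); apply/seteqP; split => t /=.
    move=> At; split.
      by move=> j ji jk; have := At j; rewrite mxE (negbTE ji) (negbTE jk).
    split; first by have := At i; rewrite mxE eqxx.
    by have := At k; rewrite mxE eq_sym (negbTE ik) eqxx.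
  move=> [At [Bt Ct]] j; rewrite mxE; case: eqVneq => [->//|ji].
  by case: eqVneq => [->//|jk]; exact: At.
rewrite (joint_density mE (mz i) (mz k) (measurable_normal_pdf _ _)
  (measurable_normal_pdf _ _) (normal_pdf_ge0 _ _) (normal_pdf_ge0 _ _) (fine_ge0 Q0) rect mD).
rewrite fineK// (bigD1 i)//= (bigD1 k) 1?eq_sym//= muleA [RHS]muleC.
rewrite (_ : (\prod_(j < d | _) _)%E = Q); last first.
  by apply: eq_bigr => j /andP[ji jk]; rewrite mxE (negbTE ji) (negbTE jk).
congr (_ * _)%E.
set m' := givens i k c s m.
pose g' j x := normal_pdf (m' ord0 j) sigma x.
pose h (q : R * R) :=
  ((\1_(A i) q.1 * g' i q.1) * (\1_(A k) q.2 * g' k q.2))%:E.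
have h0 (q : R * R) : (0 <= h q)%E.
  by rewrite lee_fin; apply: mulr_ge0; rewrite mulr_ge0// normal_pdf_ge0.
have mh : measurable_fun [set: R * R] h.
  have mg' j : measurable_fun [set: R] (fun x => \1_(A j) x * g' j x).
    by apply: measurable_funM => //; exact: measurable_normal_pdf.
  apply/measurable_EFinP; apply: measurable_funM.
    exact: measurableT_comp (mg' i) _.
  exact: measurableT_comp (mg' k) _.
(* [givens] turns the plane in the direction opposite to that of [ge0_integral_rotation], hence the
   sine - s. *)
transitivity (\int[mu]_x \int[mu]_y h (c * x - (- s) * y, (- s) * x + c * y)%R)%E.
  apply: eq_integral => x _; apply: eq_integral => y _; rewrite /h/=.
  have -> : c * x - - s * y = c * x + s * y by ring.
  have -> : - s * x + c * y = c * y - s * x by ring.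
  congr EFin; rewrite [RHS]mulrACA; congr (_ * _).
    rewrite !indicE.
    have -> : ((x, y) \in D) = (c * x + s * y \in A i) && (c * y - s * x \in A k).
      by apply/idP/andP; rewrite !inE.
    by rewrite -mulnb natrM.
  rewrite /g' /m' !mxE eqxx eq_sym (negbTE ik) eqxx.
  exact: esym (normal_pdf_rotation (m ord0 i) (m ord0 k) x y sigma0 cs1).
have csN : c ^+ 2 + (- s) ^+ 2 = 1 by rewrite sqrrN.
rewrite (ge0_integral_rotation csN mh h0).
rewrite /h ge0_integral_prod//; try exact: measurable_normal_pdf;
  by move=> x; exact: normal_pdf_ge0.
Qed.

Lemma isotropic_gaussian_subl m (sigma : R) (x : 'rV[R]_d) (y : T -> 'rV[R]_d) :
  sigma != 0 -> isotropic_gaussian P m sigma y ->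
  isotropic_gaussian P (x - m) sigma (fun t => x - y t).
Proof.
move=> s0 [my yP]; split.
  by move=> j; under eq_fun do rewrite !mxE; exact: measurable_funB.
move=> A mA.
pose A' j := (fun a => x ord0 j - a) @^-1` A j.
have mA' j : measurable (A' j).
  by rewrite -[X in measurable X]setTI; apply: measurable_funB.
transitivity (P [set t | forall i, A' i (y t ord0 i)]).
  by congr (P _); apply/seteqP; split => t /= h i; have := h i; rewrite /A'/= !mxE.
rewrite yP//; apply: eq_bigr => j _.
rewrite /normal_prob [LHS]integral_mulr_indic [RHS]integral_mulr_indic.
pose f a := ((normal_pdf ((x - m) ord0 j) sigma a)%:E * (\1_(A j) a)%:E)%E.
have f0 a : (0 <= f a)%E by rewrite mule_ge0// lee_fin ?normal_pdf_ge0.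
have mf : measurable_fun [set: R] f.
  apply: emeasurable_funM; apply/measurable_EFinP => //.
  exact: measurable_normal_pdf.
have N10 : (-1 : R) != 0 by rewrite oppr_eq0 oner_eq0.
transitivity (\int[mu]_a (f (a * -1 + x ord0 j)%R * `|-1|%:E))%E; last first.
  exact: ge0_integral_affine.
apply: eq_integral => a _; rewrite normrN normr1 mule1 /f; symmetry.
have -> : a * -1 + x ord0 j = x ord0 j - a by ring.
congr (_%:E * _)%E.
have sqr_eq (b : R) : (x ord0 j - a - (x ord0 j - b)) ^+ 2 = (a - b) ^+ 2 by ring.
by rewrite !(normal_pdfE _ s0) /normal_fun !mxE sqr_eq.
Qed.

End rotations.

(** * Moving the direction and the mean into the first two coordinates *)

Section canonical_position.
Context {R : realType} (sigma : R).
Context disp (T : measurableType disp) (P : probability T R).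
Hypothesis sigma0 : sigma != 0.

Definition gaussian_isometry d (Q : 'rV[R]_d -> 'rV[R]_d) :=
  (forall u w, dotv (Q u) (Q w) = dotv u w) /\
  (forall m (z : T -> 'rV[R]_d), isotropic_gaussian P m sigma z ->
     isotropic_gaussian P (Q m) sigma (fun t => Q (z t))).

(** One rotation per index of [K] moves that coordinate of [v] into coordinate [i], which becomes
    the nonnegative square root [rho]; an empty [K] gives no control of its sign. The last clause
    lets a second such isometry preserve what a first one achieved. *)
Lemma gaussian_isometry_zero_out d (i : 'I_d) (K : seq 'I_d) (v : 'rV[R]_d) :
  i \notin K ->
  exists Q, [/\ gaussian_isometry Q, (forall k, k \in K -> (Q v) ord0 k = 0),
    (K != [::] -> 0 <= (Q v) ord0 i) &
    (forall u : 'rV[R]_d, u ord0 i = 0 -> (forall k, k \in K -> u ord0 k = 0) ->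
       Q u = u)].
Proof.
elim: K => [_|k K IH]; first by exists id; split.
rewrite inE negb_or => /andP[ik iK].
have [Q [[Qdot Qiso] Q0 Qi Qfix]] := IH iK.
set w := Q v; set rho := Num.sqrt (w ord0 i ^+ 2 + w ord0 k ^+ 2).
have rho2 : rho ^+ 2 = w ord0 i ^+ 2 + w ord0 k ^+ 2.
  by rewrite sqr_sqrtr// addr_ge0// sqr_ge0.
(* Both coordinates already vanish, and the angle of the rotation would be undefined. *)
have [rho0|rho0] := eqVneq rho 0.
  move: rho2; rewrite rho0 expr0n/= => /esym/eqP.
  rewrite paddr_eq0 ?sqr_ge0// !sqrf_eq0 => /andP[/eqP wi /eqP wk].
  exists Q; split=> //.
  - by move=> j; rewrite inE => /predU1P[->//|]; exact: Q0.
  - by move=> _; rewrite -/w wi.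
  - by move=> u ui uK; apply: Qfix => // j jK; apply: uK; rewrite inE jK orbT.
set c := w ord0 i / rho; set s := w ord0 k / rho.
have cs1 : c ^+ 2 + s ^+ 2 = 1.
  by rewrite !expr_div_n -mulrDl -rho2 divff// expf_neq0.
have wi : c * w ord0 i + s * w ord0 k = rho.
  apply: (mulIf rho0); rewrite -[RHS]expr2 rho2 /c /s; field; exact: rho0.
exists (givens i k c s \o Q); split.
- split; first by move=> a b; rewrite /= dotv_givens// Qdot.
  by move=> m z zP; apply: isotropic_gaussian_givens => //; exact: Qiso.
- move=> j; rewrite inE /= mxE; have [->|jk] /= := eqVneq j k.
    by rewrite eq_sym (negbTE ik) => _; rewrite -/w /c /s; field.
  by move=> jK; rewrite (negbTE (memPn iK _ jK)) Q0.
- by move=> _; rewrite /= mxE eqxx wi sqrtr_ge0.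
- move=> u ui uK /=; rewrite Qfix//; last first.
    by move=> j jK; apply: uK; rewrite inE jK orbT.
  have uk : u ord0 k = 0 by apply: uK; rewrite mem_head.
  apply/rowP => j; rewrite mxE ui uk !mulr0 subr0 addr0.
  by case: eqVneq => [->//|_]; case: eqVneq => [->|].
Qed.

(** [Q] aligns [v] with the axis of [ord0]. [S] then clears the coordinates beyond [i1] of the mean;
    it fixes [Q v], which is zero at [i1] and on [K1], so both alignments hold together. *)
Lemma isotropic_gaussian_canonical n (v m : 'rV[R]_n.+2) (z : T -> 'rV[R]_n.+2) :
  isotropic_gaussian P m sigma z ->
  exists Z m', [/\ isotropic_gaussian P m' sigma Z,
    (forall t, dotv v (z t) = enorm v * Z t ord0 ord0),
    (forall t, enorm (z t) = enorm (Z t)),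
    enorm m' = enorm m &
    (forall k : 'I_n.+2, (1 < k)%N -> m' ord0 k = 0)].
Proof.
move=> zP.
pose i1 : 'I_n.+2 := lift ord0 ord0.
pose K0 := [seq k <- enum 'I_n.+2 | k != ord0].
pose K1 := [seq k : 'I_n.+2 <- enum 'I_n.+2 | (1 < k)%N].
have mK0 k : (k \in K0) = (k != ord0) by rewrite mem_filter mem_enum andbT.
have mK1 k : (k \in K1) = (1 < k)%N by rewrite mem_filter mem_enum andbT.
have K0n : K0 != [::].
  by apply/eqP => K00; have := mK0 i1; rewrite K00.
have [Q [[Qdot Qiso] Q0 Qi Qfix]] :=
  @gaussian_isometry_zero_out _ ord0 K0 v (negbT (mK0 ord0)).
have [S [[Sdot Siso] S0 Si Sfix]] :=
  @gaussian_isometry_zero_out _ i1 K1 (Q m) (negbT (mK1 i1)).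
have Qv k : k != ord0 -> (Q v) ord0 k = 0 by rewrite -mK0; exact: Q0.
have SQv : S (Q v) = Q v.
  apply: Sfix; first exact: Qv.
  by move=> k; rewrite mK1 => k1; apply: Qv; case: k k1 => -[].
have dotQv w : dotv (Q v) w = (Q v) ord0 ord0 * w ord0 ord0.
  rewrite /dotv (bigD1 ord0)//= big1 ?addr0// => j j0.
  by rewrite Qv// mul0r.
have Qv0 : (Q v) ord0 ord0 = enorm v.
  by rewrite /enorm -Qdot dotQv -expr2 sqrtr_sqr ger0_norm// Qi.
exists (fun t => S (Q (z t))), (S (Q m)); split.
- exact/Siso/Qiso.
- by move=> t; rewrite -Qdot -Sdot SQv dotQv Qv0.
- by move=> t; rewrite /enorm Sdot Qdot.
- by rewrite /enorm Sdot Qdot.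
- by move=> k k1; apply: S0; rewrite mK1.
Qed.

End canonical_position.

(** * Densities of norms of Gaussian vectors *)

Section radial_densities.
Context {R : realType} (sigma : R).
Local Notation mu := (@lebesgue_measure R).
Hypothesis sigma0 : sigma != 0.

(* Up to a constant factor, the density of the norm of a Gaussian vector of R^(n+1)
   whose mean has norm [|b|]. *)
Definition radial_density n b r : R :=
  \1_(`]0, +oo[%classic) r *
    (r ^+ n * normal_fun 0 sigma r * axial_factor n (b * r / sigma ^+ 2)).

Lemma measurable_axial_factor n : measurable_fun [set: R] (axial_factor n).
Proof. by apply: continuous_measurable_fun; have [] := log_tilted_axial_factor (R := R) n. Qed.

Lemma axial_factor_gt0 n c : 0 < axial_factor n c :> R.
Proof. by have [_] := log_tilted_axial_factor (R := R) n. Qed.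

Lemma measurable_radial_density n b : measurable_fun [set: R] (radial_density n b).
Proof.
apply: measurable_funM; first exact: measurable_indic.
apply: measurable_funM; last first.
  apply: measurableT_comp; first exact: measurable_axial_factor.
  by apply: measurable_funM => //; exact: measurable_funM.
apply: measurable_funM; first exact: measurable_funX.
exact: measurable_normal_fun.
Qed.

Lemma radial_density_ge0 n b r : 0 <= radial_density n b r.
Proof.
rewrite /radial_density indicE; case: (boolP (r \in _)); last by rewrite mul0r.
rewrite inE/= in_itv/= andbT mul1r => r0.
by rewrite mulr_ge0 ?(ltW (axial_factor_gt0 _ _))// mulr_ge0 ?expR_ge0// exprn_ge0 ?ltW.
Qed.

Lemma radial_density_le0 n b r : r <= 0 -> radial_density n b r = 0.
Proof.
move=> r0; rewrite /radial_density indicE memNset ?mul0r//=.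
by rewrite in_itv/= andbT; apply/negP; rewrite -leNgt.
Qed.

Lemma radial_density_pos n b r : 0 < r ->
  radial_density n b r = r ^+ n * normal_fun 0 sigma r * axial_factor n (b * r / sigma ^+ 2).
Proof.
by move=> r0; rewrite /radial_density indicE mem_set ?mul1r//= in_itv/= r0.
Qed.

(** The density of N(b, sigma^2) at 0. *)
Definition tilt_mass b : R := normal_peak sigma * expR (- b ^+ 2 / (sigma ^+ 2 *+ 2)).

Lemma tilt_mass_gt0 b : 0 < tilt_mass b.
Proof. by rewrite mulr_gt0 ?expR_gt0// normal_peak_gt0. Qed.

(** Expand (r cos t - b)^2 + (r sin t)^2 = r^2 - 2 b r cos t + b^2. The angle survives only in the
    weight that [axial_factor] integrates. *)
Lemma normal_pdf_polar b r t : normal_pdf b sigma (r * cos t) * normal_fun 0 sigma (r * sin t) =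
  tilt_mass b * normal_fun 0 sigma r * expR (b * r / sigma ^+ 2 * cos t).
Proof.
rewrite (normal_pdfE _ sigma0) /normal_fun /tilt_mass -!mulrA; congr (_ * _).
rewrite -!expRD; congr expR.
have e : r ^+ 2 = r ^+ 2 * (cos t ^+ 2 + sin t ^+ 2) by rewrite cos2Dsin2 mulr1.
rewrite !subr0 [in RHS]e -mulr_natr; field.
by rewrite sigma0.
Qed.

(** The step that adds one coordinate, of mean b, to a centred tail: (r sin t)^e and the Jacobian r
    combine to r^(e+1) sin(t)^e, and integrating out t produces [axial_factor e.+1]. *)
Lemma radial_density_polar e b C r : 0 < r ->
  (\int[mu]_(t in `[0%R, pi])
     (normal_pdf b sigma (r * cos t) * (C * radial_density e 0 (r * sin t)) * r)%:E)%E =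
  (C * (tilt_mass b * axial_factor e 0) * radial_density e.+1 b r)%:E :> \bar R.
Proof.
move=> r0.
pose K := C * (tilt_mass b * axial_factor e 0) * (r ^+ e.+1 * normal_fun 0 sigma r).
pose f t := axial_integrand e (b * r / sigma ^+ 2, t).
have cf : continuous f by exact: continuous_axial_slice.
have mf : measurable_fun [set: R] f by exact: continuous_measurable_fun.
have mg : measurable_fun [set: R] (fun t =>
    normal_pdf b sigma (r * cos t) * (C * radial_density e 0 (r * sin t)) * r).
  apply: measurable_funM => //; apply: measurable_funM.
    apply: (measurableT_comp (measurable_normal_pdf _ _)).
    by apply: measurable_funM => //; exact: measurable_cos.
  apply: measurable_funM => //.
  apply: (measurableT_comp (measurable_radial_density _ _)).
  by apply: measurable_funM => //; exact: measurable_sin.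
transitivity (\int[mu]_(t in `[0%R, pi]) (K%:E * (f t)%:E))%E; last first.
  rewrite integralZl//; last exact: integrable_0pi.
  rewrite EFin_Rintegral_0pi// -EFinM /K; congr EFin.
  by rewrite radial_density_pos// !mulrA.
rewrite integral_itv_bndoo; last by apply/measurable_EFinP; exact: measurable_funTS.
rewrite [RHS]integral_itv_bndoo; last first.
  apply: measurable_funTS; apply: emeasurable_funM => //.
  exact/measurable_EFinP.
apply: eq_integral => t; rewrite inE/= in_itv/= => tpi.
have st : 0 < sin t by exact: sin_gt0_pi.
rewrite -EFinM; congr EFin; rewrite radial_density_pos ?mulr_gt0// !mul0r.
rewrite /K /f /axial_integrand/= exprMn [r ^+ e.+1]exprS.
set A := axial_factor e 0; set a := r ^+ e; set s := sin t ^+ e.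
transitivity (C * A * a * s * r *
  (normal_pdf b sigma (r * cos t) * normal_fun 0 sigma (r * sin t))); first by ring.
by rewrite normal_pdf_polar; ring.
Qed.

Lemma normal_prob_norm b (B : set R) : measurable B ->
  normal_prob b sigma [set x | B `|x|] =
  (\int[mu]_(r in B) (tilt_mass b * radial_density 0 b r)%:E)%E.
Proof.
move=> mB.
pose g (x : R) := ((normal_pdf b sigma x)%:E * (\1_B `|x|)%:E)%E.
have g0 x : (0 <= g x)%E by rewrite mule_ge0// lee_fin normal_pdf_ge0.
have mg : measurable_fun [set: R] g.
  apply: emeasurable_funM; apply/measurable_EFinP.
    exact: measurable_normal_pdf.
  exact: measurableT_comp (measurable_indic mB) _.
have mgN : measurable_fun [set: R] (fun x => g (- x)) by exact: measurableT_comp.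
rewrite /normal_prob integral_mulr_indic [RHS]integral_mulr_indic.
transitivity (\int[mu]_x g x)%E.
  apply: eq_integral => x _; rewrite /g !indicE; congr (_ * _%:E)%E.
have setT_split : [set: R] = `]-oo, 0%R]%classic `|` `]0%R, +oo[%classic.
  by apply/seteqP; split=> // x _ /=; rewrite !in_itv/= andbT; case: (leP (x : R) 0%R); [left|right].
rewrite [in LHS]setT_split ge0_integral_setU//=; last 2 first.
- exact: measurable_funTS.
- rewrite disj_set2E; apply/eqP; rewrite -subset0 => x []/=.
  by rewrite !in_itv/= andbT leNgt => /negP.
have -> : (\int[mu]_(x in `]-oo, 0%R]) g x = \int[mu]_(x in `]0%R, +oo[) g (- x)%R)%E.
  rewrite integral_itv_obnd_cbnd; last exact: measurable_funTS.
  rewrite ge0_integration_by_substitution0//.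
  by apply: eq_integral => x _; rewrite opprK.
rewrite -ge0_integralD//; [|exact: measurable_funTS|exact: measurable_funTS].
rewrite [LHS]integral_mulr_indic; apply: eq_integral => x _.
have [x0|x0] := leP (x : R) 0%R.
  rewrite radial_density_le0// mulr0 mul0e indicE memNset ?mule0//=.
  by rewrite in_itv/= andbT; apply/negP; rewrite -leNgt.
rewrite indicE mem_set ?mule1/=; last by rewrite in_itv/= x0.
rewrite /g normrN gtr0_norm// -ge0_muleDl ?lee_fin ?normal_pdf_ge0//.
congr (_ * _)%E; rewrite -EFinD; congr EFin.
(* The two signs of x are the angles 0 and pi; their sum is the two-point case of [axial_factor]. *)
have := normal_pdf_polar b x 0; have := normal_pdf_polar b x pi.
rewrite cospi sinpi cos0 sin0 !mulr0 !mulr1 !mulrN1.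
have -> : normal_fun 0 sigma 0 = 1 :> R by rewrite /normal_fun subrr expr0n/= oppr0 mul0r expR0.
rewrite !mulr1 => -> ->; rewrite radial_density_pos//= expr0; ring.
Qed.

End radial_densities.

(** * Law of the norm of the last coordinates, given the first ones *)

Section tail_norm.
Context {R : realType} (sigma : R) (n : nat).
Local Notation mu := (@lebesgue_measure R).
Hypothesis sigma0 : sigma != 0.
Context disp (T : measurableType disp) (P : probability T R).
Variables (m : 'rV[R]_n.+2) (z : T -> 'rV[R]_n.+2).
Hypothesis zP : isotropic_gaussian P m sigma z.

Definition tail_norm k t : R := Num.sqrt (\sum_(j < n.+2 | (k <= j)%N) z t ord0 j ^+ 2).

Definition head_event k (A : 'I_n.+2 -> set R) : set T :=
  [set t | forall j : 'I_n.+2, (j < k)%N -> A j (z t ord0 j)].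

Definition head_mass k (A : 'I_n.+2 -> set R) : \bar R :=
  (\prod_(j < n.+2 | (j < k)%N) normal_prob (m ord0 j) sigma (A j))%E.

Lemma measurable_coord j : measurable_fun [set: T] (fun t => z t ord0 j).
Proof. by have [] := zP. Qed.

Lemma measurable_tail_norm k : measurable_fun [set: T] (tail_norm k).
Proof.
apply: (measurableT_comp measurable_sqrtr).
under eq_fun do rewrite big_mkcond.
apply: measurable_sum => j; case: (k <= j)%N => //.
by apply: measurable_funX; exact: measurable_coord.
Qed.

Lemma measurable_head_event k A : (forall j, measurable (A j)) ->
  measurable (head_event k A).
Proof.
move=> mA.
have -> : head_event k A = \bigcap_(j in [set j : 'I_n.+2 | (j < k)%N])
    (fun t => z t ord0 j) @^-1` A j.
  by apply/seteqP; split => t At j jk; exact: At.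
apply: fin_bigcap_measurable; first exact: finite_finset.
by move=> j _; rewrite -[X in measurable X]setTI; exact: measurable_coord.
Qed.

Lemma head_mass_fin k A : (forall j, measurable (A j)) -> head_mass k A \is a fin_num.
Proof. by move=> mA; apply: prode_fin_num => j _; apply: fin_num_measure; exact: mA. Qed.

Lemma head_mass_ge0 k A : (0 <= head_mass k A)%E.
Proof. by apply: prode_ge0 => j _; exact: measure_ge0. Qed.

Lemma tail_normS (k : 'I_n.+2) t :
  tail_norm k t = norm2 (z t ord0 k, tail_norm k.+1 t).
Proof.
rewrite /norm2 /tail_norm /= sqr_sqrtr; last by apply: sumr_ge0 => j _; exact: sqr_ge0.
rewrite (bigD1 k)//=; congr (Num.sqrt (_ + _)); apply: eq_bigl => j.
by rewrite andbC [RHS]ltn_neqAle eq_sym.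
Qed.

Lemma head_eventS (k : 'I_n.+2) A (B : set R) :
  head_event k.+1 (fun j => if j == k then B else A j) =
  head_event k A `&` (fun t => z t ord0 k) @^-1` B.
Proof.
apply/seteqP; split => t /=.
  move=> At; split; last by have := At k (ltnSn _); rewrite eqxx.
  by move=> j jk; have := At j (ltnW jk); rewrite -val_eqE/= ltn_eqF.
move=> [At Bt] j jk; case: eqVneq => [->//|j_k]; apply: At.
by rewrite ltn_neqAle -val_eqE/= in j_k *; rewrite j_k.
Qed.

Lemma head_massS (k : 'I_n.+2) A (B : set R) :
  head_mass k.+1 (fun j => if j == k then B else A j) =
  (head_mass k A * normal_prob (m ord0 k) sigma B)%E.
Proof.
rewrite /head_mass (bigD1 k)//= eqxx muleC; congr (_ * _)%E.
apply: eq_big => j; first by rewrite ltnS andbC -ltn_neqAle.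
by move=> /andP[_ /negbTE->].
Qed.

(* Backwards in [k]: [tail_norm k] is the polar radius of the pair formed by the
   k-th coordinate and [tail_norm k.+1]. *)
Lemma tail_norm_law i (k : nat) : (k + i = n.+1)%N ->
  (forall j : 'I_n.+2, (k < j)%N -> m ord0 j = 0) ->
  exists2 C : R, 0 < C & forall A B, (forall j, measurable (A j)) -> measurable B ->
    P (head_event k A `&` tail_norm k @^-1` B) =
    (head_mass k A *
     \int[mu]_(r in B) (C * radial_density sigma i (m ord0 (inord k)) r)%:E)%E.
Proof.
elim: i k => [|i IH] k.
  rewrite addn0 => -> _; exists (tilt_mass sigma (m ord0 (inord n.+1))).
    exact: tilt_mass_gt0.
  move=> A B mA mB; rewrite -normal_prob_norm//.
  have kE : inord n.+1 = ord_max :> 'I_n.+2 by apply: val_inj; rewrite /= inordK.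
  set D := [set x | B `|x|].
  have mD : measurable D.
    rewrite -[X in measurable X]setTI.
    by apply: (_ : measurable_fun [set: R] (fun x => `|x|)).
  rewrite kE -(head_massS ord_max) /head_mass.
  have zPA := zP.2 (fun j => if j == ord_max then D else A j).
  transitivity (P (head_event n.+2 (fun j => if j == ord_max then D else A j))).
    rewrite (head_eventS ord_max); congr (P (_ `&` _)).
    apply/seteqP; split => t; rewrite /D /= /tail_norm (big_pred1 ord_max) ?sqrtr_sqr// => j;
      by rewrite /= -val_eqE/= eqn_leq leq_ord.
  transitivity (P [set t | forall j, (if j == ord_max then D else A j) (z t ord0 j)]).
    by congr (P _); apply/seteqP; split => t h j; [exact: h j (ltn_ord j)|move=> _; exact: h].
  rewrite zPA; last by move=> j; case: ifP.
  by apply: eq_bigl => j; rewrite ltn_ord.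
move=> kin mk.
have kn : (k < n.+2)%N by rewrite ltnS -kin leq_addr.
pose kk := Ordinal kn.
have [C C0 law] : exists2 C : R, 0 < C & forall A B,
    (forall j, measurable (A j)) -> measurable B ->
    P (head_event k.+1 A `&` tail_norm k.+1 @^-1` B) =
    (head_mass k.+1 A *
     \int[mu]_(r in B) (C * radial_density sigma i 0 r)%:E)%E.
  have [|j kj|C C0 law] := IH k.+1.
  - by rewrite addSnnS.
  - by apply: mk; exact: ltnW.
  (* Only coordinate k of the tail may have a nonzero mean; the remaining tail is centred, as
     [radial_density_polar] requires. *)
  have mk0 : m ord0 (inord k.+1) = 0.
    by apply: mk; rewrite inordK// -kin addnS !ltnS leq_addr.
  by exists C; [exact: C0|move=> A B mA mB; rewrite (law A B mA mB) mk0].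
have kE : inord k = kk by apply: val_inj; rewrite /= inordK.
rewrite kE; exists (C * (tilt_mass sigma (m ord0 kk) * axial_factor i 0)).
  apply: mulr_gt0 => //; apply: mulr_gt0; last exact: axial_factor_gt0.
  exact: tilt_mass_gt0.
move=> A B mA mB.
have mC : measurable_fun [set: R] (fun r => C * radial_density sigma i 0 r).
  by apply: measurable_funM => //; exact: measurable_radial_density.
have C_ge0 r : 0 <= C * radial_density sigma i 0 r.
  by rewrite mulr_ge0 ?(ltW C0)// radial_density_ge0.
have rect (X Y : set R) : measurable X -> measurable Y ->
    P (head_event k A `&` ((fun t => z t ord0 kk) @^-1` X `&` tail_norm k.+1 @^-1` Y)) =
    ((fine (head_mass k A))%:E * (\int[mu]_(x in X) (normal_pdf (m ord0 kk) sigma x)%:E *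
       \int[mu]_(y in Y) (C * radial_density sigma i 0 y)%:E))%E.
  move=> mX mY; rewrite setIA -(head_eventS kk) law//; last first.
    by move=> j; case: ifP.
  by rewrite (head_massS kk) fineK ?head_mass_fin// muleA.
have := density_norm2 (measurable_head_event k mA) (measurable_coord kk)
  (measurable_tail_norm k.+1) (measurable_normal_pdf _ _) mC
  (normal_pdf_ge0 _ _) C_ge0 (fine_ge0 (head_mass_ge0 k A)) rect _
  (rho := fun r => C * (tilt_mass sigma (m ord0 kk) * axial_factor i 0) *
                   radial_density sigma i.+1 (m ord0 kk) r) _ _ mB.
rewrite fineK ?head_mass_fin// => <-.
- by congr (P (_ `&` _)); apply/seteqP; split => t; rewrite /= (tail_normS kk).
- by move=> y y0; rewrite radial_density_le0// mulr0.
- by move=> r r0; rewrite radial_density_le0// mulr0.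
- by move=> r r0; rewrite radial_density_polar.
Qed.

End tail_norm.

Section monotonicity.
Import HBNNSimple.

(* Monotonicity without measurability of [f] and [g]: nothing makes the inner integral
   in [conditional_angle_density] a measurable function of the radius. *)
Lemma ge0_le_integral_nomeas d (T : measurableType d) (R : realType)
    (m : {measure set T -> \bar R}) (D : set T) (f g : T -> \bar R) :
  (forall x, D x -> (0 <= f x)%E) -> (forall x, D x -> (f x <= g x)%E) ->
  (\int[m]_(x in D) f x <= \int[m]_(x in D) g x)%E.
Proof.
move=> f0 fg; have g0 x : D x -> (0 <= g x)%E.
  by move=> Dx; apply: le_trans (fg _ Dx); exact: f0.
rewrite !ge0_integralE//; apply: ereal_sup_le => _ [h hf <-].
exists h => // x; apply: le_trans (hf x) _.
by rewrite /patch; case: ifP => // /set_mem; exact: fg.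
Qed.

End monotonicity.

(** * The normalised kernel as a conditional density, and its maximality *)

Section conditional_density.
Context {R : realType} disp (T : measurableType disp) (P : probability T R).
Local Notation mu := (@lebesgue_measure R).
Variables (phi rho : T -> R) (q : R -> R) (G : R * R -> R).
Hypotheses (mrho : measurable_fun [set: T] rho) (mq : measurable_fun [set: R] q).
Hypothesis mphi : measurable_fun [set: T] phi.
Hypotheses (phi_itv : forall t, 0 <= phi t <= pi).
Hypotheses (q0 : forall r, 0 <= q r) (q_gt0 : forall r, 0 < r -> 0 < q r).
Hypotheses (cG : continuous G) (mG : measurable_fun [set: R * R] G).
Hypotheses (G0 : forall r t, 0 <= t <= pi -> 0 <= G (r, t)).
Hypotheses (G_gt0 : forall r t, 0 < t < pi -> 0 < G (r, t)).
Hypothesis law : forall A B, measurable A -> measurable B -> A `<=` `[0, pi]%classic ->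
  P (phi @^-1` A `&` rho @^-1` B) =
  (\int[mu]_(r in B) \int[mu]_(t in A) (q r * G (r, t))%:E)%E.

Let N r := \int[mu]_(t in `[0, pi]) G (r, t).

Let cGr r : continuous (fun t => G (r, t)).
Proof.
move=> t; apply: (continuous_comp ((continuous_pair_slice r).1 t)); exact: cG.
Qed.

Let N_gt0 r : 0 < N r.
Proof.
by apply: Rintegral_0pi_gt0; [exact: cGr|move=> t; exact: G0|move=> t; exact: G_gt0].
Qed.

Let cN : continuous N. Proof. exact: continuous_Rintegral_0pi. Qed.

Let mN : measurable_fun [set: R] N.
Proof. exact: continuous_measurable_fun. Qed.

Let f0 r t := G (r, t) / N r.

Let f00 r t : 0 <= t <= pi -> 0 <= f0 r t.
Proof. by move=> tpi; rewrite divr_ge0 ?G0// ltW. Qed.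

Let mf0 : measurable_fun [set: R * R] (fun z => f0 z.1 z.2).
Proof.
apply: measurable_funM.
  have -> : (fun z => G (z.1, z.2)) = G by apply/funext => -[].
  exact: mG.
by apply: measurable_funV; exact: measurableT_comp mN _.
Qed.

Let law_radius B : measurable B ->
  P (rho @^-1` B) = (\int[mu]_(r in B) (q r * N r)%:E)%E.
Proof.
move=> mB; have := @law `[0, pi]%classic B (measurable_itv _) mB (fun _ => id).
rewrite (_ : phi @^-1` _ = setT) ?setTI; last first.
  by apply/seteqP; split=> // t _; rewrite /= in_itv/= phi_itv.
move=> ->; apply: eq_integral => r _.
under eq_integral do rewrite EFinM.
rewrite integralZl//; last exact: integrable_0pi.
by rewrite EFin_Rintegral_0pi.
Qed.

(** By [law_radius] the law of [rho] and the measure with density q N are the same measure, so they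
    integrate [h] alike. *)
Let integral_radius B (psi : R -> \bar R) : measurable B ->
  measurable_fun [set: R] psi -> (forall r, (0 <= psi r)%E) ->
  (\int[P]_(t in rho @^-1` B) psi (rho t) = \int[mu]_(r in B) (psi r * (q r * N r)%:E))%E.
Proof.
move=> mB mpsi psi0.
have mqN : measurable_fun [set: R] (fun r => q r * N r) by exact: measurable_funM.
have qN0 r : 0 <= q r * N r by rewrite mulr_ge0 ?(ltW (N_gt0 _)).
have [nu1 [nu1E nu1I]] := @image_measure _ _ T (measurableTypeR R) R P rho mrho.
have [nu2 [nu2E nu2I]] := @density_measure _ (measurableTypeR R) R mu _ mqN qN0.
pose h r := (psi r * (\1_B r)%:E)%E.
have h0 r : (0 <= h r)%E by rewrite mule_ge0.
have mh : measurable_fun [set: R] h.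
  by apply: emeasurable_funM => //; exact/measurable_EFinP/measurable_indic.
transitivity (\int[nu1]_r h r)%E.
  rewrite nu1I// [LHS]integral_mkcond; apply: eq_integral => t _.
  rewrite /patch /h indicE (_ : (t \in rho @^-1` B) = (rho t \in B)); last first.
    by apply/idP/idP; rewrite !inE.
  by case: ifP => _; rewrite ?mule1 ?mule0.
transitivity (\int[nu2]_r h r)%E.
  apply: eq_measure_integral => A mA _.
  by rewrite nu1E nu2E; exact: law_radius.
rewrite nu2I// [RHS]integral_mulr_indic; apply: eq_integral => r _.
by rewrite /h -muleA [X in (_ * X)%E]muleC muleA.
Qed.

Let psi A r := (\int[mu]_(a in A) (f0 r a)%:E)%E.

Let mpsi A : measurable A -> A `<=` `[0, pi]%classic -> measurable_fun [set: R] (psi A).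
Proof.
move=> mA A0pi.
pose F (z : R * R) := ((f0 z.1 z.2)%:E * (\1_A z.2)%:E)%E.
have F0 z : (0 <= F z)%E.
  rewrite /F indicE; have [/set_mem/A0pi/=|_] := boolP (z.2 \in A); last by rewrite mule0.
  by rewrite in_itv/= mule1 lee_fin; exact: f00.
have mF : measurable_fun [set: R * R] F.
  apply: emeasurable_funM; apply/measurable_EFinP => //.
  exact: measurableT_comp (measurable_indic mA) _.
have -> : psi A = fun r => (\int[mu]_a F (r, a))%E.
  by apply/funext => r; rewrite /psi integral_mulr_indic.
exact: measurable_partial_integral.
Qed.

Let psi0 A r : A `<=` `[0, pi]%classic -> (0 <= psi A r)%E.
Proof.
move=> A0pi; apply: integral_ge0 => a /A0pi/=; rewrite in_itv/= lee_fin; exact: f00.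
Qed.

Let integral_f0 A B : measurable A -> measurable B -> A `<=` `[0, pi]%classic ->
  (\int[P]_(t in rho @^-1` B) psi A (rho t) = P (phi @^-1` A `&` rho @^-1` B))%E.
Proof.
move=> mA mB A0pi; rewrite integral_radius ?law//; last 2 first.
- exact: mpsi.
- by move=> r; exact: psi0.
apply: eq_integral => r _; rewrite /psi -ge0_integralZr//; last 3 first.
- apply/measurable_EFinP/measurable_funTS.
  by apply: measurable_funM => //; exact: continuous_measurable_fun.
- by move=> a /A0pi/=; rewrite in_itv/= lee_fin; exact: f00.
- by rewrite lee_fin mulr_ge0 ?(ltW (N_gt0 _)).
apply: eq_integral => a _; rewrite -EFinM /f0; congr EFin; field.
by rewrite gt_eqF.
Qed.

Lemma conditional_density_exists : conditional_angle_density P phi rho f0.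
Proof.
split.
- by move=> r a _; rewrite in_itv/=; exact: f00.
- apply: continuous_subspaceT => z; apply: cvgM.
    have -> : (fun z : R * R => G (z.1, z.2)) = G by apply/funext => -[].
    by case: z => r a; exact: cG.
  apply: cvgV; first by rewrite gt_eqF.
  exact: (continuous_fcomp (@continuous_p1 R) cN).
- by move=> A B mA mB A0pi _; rewrite -integral_f0.
Qed.

(** A null probability would force the density q N, positive on []0, +oo[], to vanish almost
    everywhere on an interval of positive length. *)
Let radius_open_gt0 x y : 0 <= x -> x < y -> (0 < P (rho @^-1` `]x, y[%classic))%E.
Proof.
move=> x0 xy; rewrite lt_neqAle measure_ge0 andbT.
apply/eqP => /esym; rewrite law_radius//.
pose g r : \bar R := (q r * N r)%:E.
have mg : measurable_fun `]x, y[ g.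
  by apply/measurable_funTS/measurable_EFinP; exact: measurable_funM.
have g0 r : (0 <= g r)%E by rewrite lee_fin mulr_ge0 ?(ltW (N_gt0 _)).
move=> gi0; have : (\int[mu]_(r in `]x, y[) `|g r| = 0)%E.
  by under eq_integral do rewrite gee0_abs//.
move/(ae_eq_integral_abs mu (measurable_itv _) mg) => [Z [mZ Z0 gZ]].
have : mu (`]x, y[%classic : set R) = 0%E.
  apply: (@measure_negligible _ _ _ mu); first exact: measurable_itv.
  exists Z; split=> // r rxy; apply: gZ => /= /(_ rxy) [] /eqP.
  apply/negP; rewrite gt_eqF// mulr_gt0// q_gt0//.
  by move: rxy; rewrite /= in_itv/= => /andP[xr _]; exact: le_lt_trans xr.
rewrite lebesgue_measure_itv/= lte_fin xy -EFinB => -[] /eqP.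
by rewrite subr_eq0 gt_eqF.
Qed.

(* Otherwise, by continuity, [f] exceeds [f0] by a constant on a rectangle, to which
   the law of [(phi, rho)] would then give more than its mass. *)
Lemma conditional_density_le f r a : conditional_angle_density P phi rho f ->
  0 < r -> 0 <= a <= pi -> f r a <= f0 r a.
Proof.
move=> [f_ge0 fc flaw] r0 api; rewrite leNgt; apply/negP => flt.
have [_ f0c _] := conditional_density_exists.
pose D : set (R * R) := `]0, +oo[%classic `*` `[0, pi]%classic.
pose h (z : R * R) := f z.1 z.2 - f0 z.1 z.2.
have Dra : D (r, a) by split; rewrite /= in_itv/= ?r0//.
have hcvg : h @ within D (nbhs (r, a)) --> h (r, a).
  apply: (@cvgB _ R^o).
    by move/subspace_continuousP : fc => /(_ _ Dra).
  by move/subspace_continuousP : f0c => /(_ _ Dra).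
pose eps := h (r, a) / 2.
have eps0 : 0 < eps by rewrite divr_gt0// subr_gt0.
have heps : eps < h (r, a) by rewrite /eps; move: eps0; rewrite /eps; lra.
have := @cvgr_gt R _ _ (within_filter D (nbhs_filter (r, a))) h _ hcvg _ heps.
rewrite near_withinE => near_eps.
have [de /= de0 near_h] : nbhs_ball (r, a) [set z | D z -> eps < h z].
  exact/nbhs_ballP.
have pi2 := @pi_ge2 R.
(* A nondegenerate interval of angles near [a] that stays in [0, pi], even if [a] is an endpoint: to
   the right of [a] when a <= 1, to the left otherwise. Its length is at most 1, and pi >= 2 leaves
   room. *)
have [p [s [ps p0 spi psa]]] : exists p s, [/\ p < s, 0 <= p, s <= pi &
    forall x, p <= x <= s -> `|a - x| < de].
  pose k := Num.min (de / 2) 1.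
  have k0 : 0 < k by rewrite lt_min; apply/andP; split; lra.
  have kde : k < de by rewrite /k gt_min; apply/orP; left; lra.
  have k1 : k <= 1 by rewrite /k ge_min lexx orbT.
  case/andP : api => a0 api; have [a1|a1] := leP a 1.
    exists a, (a + k); split; [lra|lra|lra|].
    by move=> x /andP[ax xak]; rewrite distrC ger0_norm; lra.
  exists (a - k), a; split; [lra|lra|lra|].
  by move=> x /andP[ax xak]; rewrite ger0_norm; lra.
(* The bound by [r] keeps the radii of [B] positive. *)
pose et := Num.min de r.
have et0 : 0 < et by rewrite lt_min de0.
pose B : set R := `](r - et), (r + et)[%classic.
pose A : set R := `[p, s]%classic.
have mA : measurable A by exact: measurable_itv.
have mB : measurable B by exact: measurable_itv.
have A0pi : A `<=` `[0, pi]%classic by apply: subset_itvScc; rewrite bnd_simp.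
have etr : et <= r by rewrite /et ge_min lexx orbT.
have etde : et <= de by rewrite /et ge_min lexx.
have B0 : B `<=` `]0, +oo[%classic.
  by move=> x; rewrite /B /= !in_itv/= andbT => /andP[? ?]; lra.
have fge x b : B x -> A b -> f0 x b + eps <= f x b.
  rewrite /B /A /= !in_itv/= => Bx Ab.
  rewrite -lerBrDl; apply/ltW; apply: (near_h (x, b)).
    split; last exact: psa.
    by rewrite /ball/=; case/andP : Bx => ? ?; rewrite ltr_norml; apply/andP; split; lra.
  by split; [apply: B0; rewrite /B /= in_itv|apply: A0pi; rewrite /A /= in_itv].
have mPB : measurable (rho @^-1` B) by rewrite -[X in measurable X]setTI; exact: mrho.
have sp0 : 0 <= s - p by lra.
have mf0r x : measurable_fun A (fun b => (f0 x b)%:E).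
  apply/measurable_EFinP/measurable_funTS; apply: measurable_funM => //.
  exact: continuous_measurable_fun.
(* [f] and [f0] give the same probability on the rectangle although [f] exceeds [f0] there by at
   least [eps]; since this probability is finite and [rho] meets [B] with positive probability, that
   is absurd. *)
have key : (P (phi @^-1` A `&` rho @^-1` B) + (eps * (s - p))%:E * P (rho @^-1` B) <=
    P (phi @^-1` A `&` rho @^-1` B))%E.
  rewrite [leRHS]flaw// -[X in (X + _)%E]integral_f0//.
  rewrite -integral_cst// -ge0_integralD//; last 3 first.
  - by move=> t _; exact: psi0.
  - apply: measurable_funTS; apply: measurableT_comp mrho.
    exact: mpsi.
  - by move=> t _; rewrite lee_fin mulr_ge0// ltW.
  apply: ge0_le_integral_nomeas => t Bt.
    by rewrite adde_ge0 ?psi0// lee_fin mulr_ge0// ltW.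
  have -> : ((eps * (s - p))%:E = \int[mu]_(b in A) eps%:E)%E.
    by rewrite integral_cst// [X in (_ * X)%E]lebesgue_measure_itv/= lte_fin ps -EFinB -EFinM.
  rewrite /psi -ge0_integralD//; last 3 first.
  - by move=> b Ab; have := A0pi _ Ab; rewrite /= in_itv/= lee_fin; exact: f00.
  - exact: mf0r.
  - by move=> b _; rewrite lee_fin ltW.
  apply: ge0_le_integral_nomeas => b Ab; last by rewrite -EFinD lee_fin fge.
  rewrite -EFinD lee_fin addr_ge0 ?(ltW eps0)// f00//.
  by have := A0pi _ Ab; rewrite /= in_itv.
have PBgt0 : (0 < P (rho @^-1` B))%E by apply: radius_open_gt0; lra.
have PABfin : P (phi @^-1` A `&` rho @^-1` B) \is a fin_num.
  apply: fin_num_measure; apply: measurableI => //.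
  by rewrite -[X in measurable X]setTI; exact: mphi.
move: key; apply/negP; rewrite -ltNge lteDl//.
by rewrite mule_gt0// lte_fin mulr_gt0// subr_gt0.
Qed.

End conditional_density.

(** * The unnormalised angular kernel, with n = d - 2 *)

Section angular_kernel.
Context {R : realType}.

Definition angular (J : R -> R) k (al be t : R) : R :=
  sin t ^+ k * (expR (al * cos t) * J (be * sin t)).

Definition angle_kernel n (sigma a b : R) (z : R * R) : R :=
  angular (axial_factor n) n (a * z.1 / sigma ^+ 2) (b * z.1 / sigma ^+ 2) z.2.

Definition radius_weight n (sigma C r : R) : R :=
  \1_(`]0, +oo[%classic) r * (C * (r ^+ n.+1 * normal_fun 0 sigma r)).

Lemma continuous_angle_kernel n sigma a b : continuous (angle_kernel n sigma a b).
Proof.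
have clin (c : R) : continuous (fun z : R * R => c * z.1 / sigma ^+ 2).
  apply: continuous_fM; last by move=> z; exact: cvg_cst.
  by apply: continuous_fM; [move=> z; exact: cvg_cst|exact: continuous_p1].
have csin : continuous (fun z : R * R => sin z.2).
  exact: (continuous_fcomp continuous_p2 (@continuous_sin R)).
apply: continuous_fM; first exact: continuous_fX.
apply: continuous_fM.
  apply: (continuous_fcomp _ (@continuous_expR R)).
  apply: continuous_fM; first exact: clin.
  exact: (continuous_fcomp continuous_p2 (@continuous_cos R)).
apply: (continuous_fcomp (h := axial_factor n)).
  by apply: continuous_fM; first exact: clin.
by have [] := log_tilted_axial_factor (R := R) n.
Qed.

Lemma measurable_angle_kernel n sigma a b :
  measurable_fun [set: R * R] (angle_kernel n sigma a b).
Proof.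
have mlin (c : R) : measurable_fun [set: R * R] (fun z => c * z.1 / sigma ^+ 2).
  by apply: measurable_funM => //; exact: measurable_funM.
have msin : measurable_fun [set: R * R] (fun z => sin z.2).
  exact: measurableT_comp measurable_sin _.
apply: measurable_funM; first exact: measurable_funX.
apply: measurable_funM.
  apply: (measurableT_comp (@measurable_expR R)).
  apply: measurable_funM; first exact: mlin.
  exact: measurableT_comp measurable_cos _.
apply: (measurableT_comp (measurable_axial_factor n)).
by apply: measurable_funM; first exact: mlin.
Qed.

Lemma angular_ge0 J k al be t : (forall c, 0 < J c) -> 0 <= t <= pi ->
  0 <= angular J k al be t.
Proof.
by move=> J0 tpi; rewrite mulr_ge0 ?exprn_ge0 ?sin_ge0_pi// mulr_ge0 ?expR_ge0// ltW.
Qed.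

Lemma angular_gt0 J k al be t : (forall c, 0 < J c) -> 0 < t < pi ->
  0 < angular J k al be t.
Proof.
by move=> J0 tpi; rewrite mulr_gt0 ?exprn_gt0 ?sin_gt0_pi// mulr_gt0 ?expR_gt0.
Qed.

End angular_kernel.

Section integral_endpoints.
Context {R : realType}.
Local Notation mu := (@lebesgue_measure R).

(** In dimension 2 the polar density vanishes at the angles 0 and pi, through the indicator in
    [radial_density], while the continuous kernel does not; the two are compared off these
    endpoints, which form a null set. *)
Lemma eq_integral_itvoo (x y : R) (A : set R) (f g : R -> \bar R) :
  measurable A -> A `<=` `[x, y]%classic ->
  measurable_fun [set: R] f -> measurable_fun [set: R] g ->
  {in `]x, y[, f =1 g} ->
  (\int[mu]_(t in A) f t = \int[mu]_(t in A) g t)%E.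
Proof.
move=> mA Axy mf mg fg.
have restr h : measurable_fun [set: R] h ->
    (\int[mu]_(t in A) h t = \int[mu]_(t in `]x, y[) (h t * (\1_A t)%:E))%E.
  move=> mh; rewrite -(@integral_itv_bndoo _ x y _ true false); last first.
    apply: measurable_funTS; apply: emeasurable_funM => //.
    exact/measurable_EFinP/measurable_indic.
  rewrite integral_mulr_indic [RHS]integral_mulr_indic; apply: eq_integral => t _.
  rewrite -muleA -EFinM !indicE; have [tA|] := boolP (t \in A); last by rewrite mul0r.
  by rewrite (_ : t \in _ = true) ?mul1r//; apply/mem_set/Axy; exact: set_mem.
rewrite !restr//; apply: eq_integral => t; rewrite inE/= => txy.
by rewrite fg.
Qed.

End integral_endpoints.

(** * Joint law of the angle and the radius *)

Section angle_radius_law.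
Context {R : realType} (sigma : R) (n : nat).
Local Notation mu := (@lebesgue_measure R).
Hypothesis sigma0 : sigma != 0.
Context disp (T : measurableType disp) (P : probability T R).
Variables (v m : 'rV[R]_n.+2) (z : T -> 'rV[R]_n.+2).
Hypothesis v0 : v != 0.
Hypothesis zP : isotropic_gaussian P m sigma z.

Lemma enorm_neq0 : enorm v != 0.
Proof.
apply: contra v0 => /eqP ev; apply/eqP/rowP => j; rewrite mxE; apply/eqP.
have sq0 i : 0 <= v ord0 i * v ord0 i by rewrite -expr2 sqr_ge0.
have : dotv v v = 0.
  apply/eqP; rewrite eq_le sumr_ge0 ?andbT// -sqrtr_eq0; exact/eqP.
move/eqP; rewrite psumr_eq0; last by move=> i _; exact: sq0.
by move/allP => /(_ j (mem_index_enum _)); rewrite implyTb mulf_eq0 orbb.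
Qed.

Lemma angle_radius_law : exists C a b, [/\ 0 < C,
  a ^+ 2 + b ^+ 2 = enorm m ^+ 2,
  measurable_fun [set: T] (fun t => angle v (z t)) /\ (forall t, 0 <= angle v (z t) <= pi),
  measurable_fun [set: T] (fun t => enorm (z t)) &
  forall A B, measurable A -> measurable B -> A `<=` `[0, pi]%classic ->
    P ((fun t => angle v (z t)) @^-1` A `&` (fun t => enorm (z t)) @^-1` B) =
    (\int[mu]_(r in B) \int[mu]_(t in A)
      (radius_weight n sigma C r * angle_kernel n sigma a b (r, t))%:E)%E].
Proof.
have [Z [m' [ZP dotvZ normZ normm m'0]]] := isotropic_gaussian_canonical sigma0 v zP.
pose i1 : 'I_n.+2 := inord 1.
have i1E : i1 = 1%N :> nat by rewrite inordK.
have [C C0 law] : exists2 C : R, 0 < C & forall A B,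
    (forall j, measurable (A j)) -> measurable B ->
    P (head_event Z 1 A `&` tail_norm Z 1 @^-1` B) =
    (head_mass sigma m' 1 A *
     \int[mu]_(r in B) (C * radial_density sigma n (m' ord0 i1) r)%:E)%E.
  by apply: tail_norm_law => //; exact: m'0.
set a := m' ord0 ord0; set b := m' ord0 i1.
pose X t := Z t ord0 ord0; pose Y t := tail_norm Z 1 t.
have mX : measurable_fun [set: T] X by exact: (measurable_coord ZP).
have mY : measurable_fun [set: T] Y by exact: (measurable_tail_norm ZP).
have XY t : enorm (z t) = norm2 (X t, Y t).
  rewrite normZ -(tail_normS Z ord0) /enorm /dotv /tail_norm; congr Num.sqrt.
have angleE t : angle v (z t) = acos (X t / norm2 (X t, Y t)).
  by rewrite /angle dotvZ XY -mulf_div divff ?enorm_neq0// mul1r.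
have mC : measurable_fun [set: R] (fun r => C * radial_density sigma n b r).
  by apply: measurable_funM => //; exact: measurable_radial_density.
have C_ge0 r : 0 <= C * radial_density sigma n b r.
  by rewrite mulr_ge0 ?(ltW C0)// radial_density_ge0.
have Cneg y : y <= 0 -> C * radial_density sigma n b y = 0.
  by move=> y0; rewrite radial_density_le0// mulr0.
have mXY : measurable_fun [set: T] (fun t => (X t, Y t)) by exact: measurable_fun_pair.
have rect A B : measurable A -> measurable B ->
    P ([set: T] `&` (X @^-1` A `&` Y @^-1` B)) =
    (1%:E * (\int[mu]_(x in A) (normal_pdf a sigma x)%:E *
             \int[mu]_(y in B) (C * radial_density sigma n b y)%:E))%E.
  move=> mA mB; rewrite setTI mul1e.
  have := law (fun=> A) B (fun=> mA) mB.
  rewrite /head_mass (big_pred1 ord0); last by move=> j; rewrite /= ltnS leqn0.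
  move=> <-; congr (P (_ `&` _)); apply/seteqP; split => t /=.
    by move=> At j; rewrite ltnS leqn0 => /eqP j0; rewrite (_ : j = ord0)//; exact: val_inj.
  by move=> /(_ ord0 isT).
have polar A B : measurable A -> measurable B -> A `<=` `[0, pi]%classic ->
    P ((fun t => angle v (z t)) @^-1` A `&` (fun t => enorm (z t)) @^-1` B) =
    (\int[mu]_(r in B) \int[mu]_(t in A) (normal_pdf a sigma (r * cos t) *
      (C * radial_density sigma n b (r * sin t)) * r)%:E)%E.
  move=> mA mB A0pi.
  have := joint_density_polar measurableT mX mY (measurable_normal_pdf a sigma) mC
    (normal_pdf_ge0 a sigma) C_ge0 ler01 rect Cneg mA mB A0pi.
  rewrite mul1e setTI => <-; congr (P (_ `&` _)); apply/seteqP; split => t /=;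
    by rewrite ?angleE ?XY.
exists (tilt_mass sigma a * C), a, b; split.
- by rewrite mulr_gt0// tilt_mass_gt0.
- rewrite -normm /enorm sqr_sqrtr; last first.
    by apply: sumr_ge0 => j _; rewrite -expr2 sqr_ge0.
  rewrite /dotv (bigD1 ord0)//= (bigD1 i1)/=; last by rewrite -val_eqE/= i1E.
  rewrite big1 ?addr0 ?expr2// => j /andP[j0 j1]; rewrite m'0 ?mul0r//.
  move: j0 j1; rewrite -!val_eqE/= i1E.
  by case: (nat_of_ord j) => [|[]].
- split; last first.
    move=> t; rewrite angleE; have h := cos_angle2_itv (X t, Y t).
    by rewrite acos_ge0// acos_lepi.
  under eq_fun do rewrite angleE.
  exact: (measurableT_comp measurable_angle2 mXY).
- under eq_fun do rewrite XY.
  exact: (measurableT_comp measurable_norm2 mXY).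
move=> A B mA mB A0pi; rewrite (polar _ _ mA mB A0pi); apply: eq_integral => r _.
have mlin h : measurable_fun [set: R] h -> measurable_fun [set: R] (fun t => r * h t).
  by move=> mh; exact: measurable_funM.
have mg1 : measurable_fun [set: R] (fun t => normal_pdf a sigma (r * cos t) *
    (C * radial_density sigma n b (r * sin t)) * r).
  apply: measurable_funM => //; apply: measurable_funM.
    exact: (measurableT_comp (measurable_normal_pdf _ _) (mlin _ measurable_cos)).
  exact: (measurableT_comp mC (mlin _ measurable_sin)).
have mg2 : measurable_fun [set: R] (fun t =>
    radius_weight n sigma (tilt_mass sigma a * C) r * angle_kernel n sigma a b (r, t)).
  apply: measurable_funM => //; apply: (measurableT_comp (measurable_angle_kernel _ _ _ _)).
  exact: measurable_pair1.
apply: (eq_integral_itvoo mA A0pi); [exact/measurable_EFinP|exact/measurable_EFinP|].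
move=> t; rewrite in_itv/= => tpi; congr EFin.
have st : 0 < sin t by exact: sin_gt0_pi.
have [r0|r0] := leP r 0.
  rewrite Cneg; last by rewrite pmulr_lle0.
  rewrite /radius_weight indicE memNset ?mulr0 ?mul0r//=.
  by rewrite in_itv/= andbT; apply/negP; rewrite -leNgt.
rewrite radial_density_pos ?mulr_gt0// /radius_weight indicE mem_set/=; last first.
  by rewrite in_itv/= r0.
rewrite /angle_kernel /angular/= exprMn mul1r [r ^+ n.+1]exprS.
rewrite mulrA (_ : b * r / sigma ^+ 2 * sin t = b * (r * sin t) / sigma ^+ 2); last by ring.
set A' := axial_factor _ _; set x := r ^+ n; set s := sin t ^+ n.
transitivity (C * A' * x * s * r *
  (normal_pdf a sigma (r * cos t) * normal_fun 0 sigma (r * sin t))); first by ring.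
by rewrite normal_pdf_polar//; ring.
Qed.

End angle_radius_law.

(** * Elementary inequalities for sine, cosine and exponential *)

Section elementary_bounds.
Context {R : realType}.
Implicit Types t x : R.

Lemma sin_le_id t : 0 <= t -> sin t <= t.
Proof.
move=> t0; have [c _ /eqP] := @MVT_segment R sin cos 0 t t0
  (fun x _ => is_derive_sin x) (continuous_subspaceT (@continuous_sin R)).
rewrite sin0 !subr0 => /eqP->.
by rewrite ler_piMl// cos_le1.
Qed.

Lemma cos_ge_sqr t : 1 - t ^+ 2 / 2 <= cos t.
Proof.
wlog t0 : t / 0 <= t => [H|].
  have [|tn] := leP 0 t; first exact: H.
  by rewrite -cosN -sqrrN; apply: H; rewrite oppr_ge0 ltW.
have -> : cos t = 1 - 2 * sin (t / 2) ^+ 2.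
  have -> : cos t = cos ((t / 2) *+ 2) by congr cos; rewrite -mulr_natr divfK.
  by rewrite cos_mulr2n cos2sin2; ring.
(* Squaring sin(t / 2) <= t / 2 needs a nonnegative sine; for t > 2 the bound sin^2 <= 1 <= (t /
   2)^2 replaces it. *)
have s0 : 0 <= sin (t / 2) \/ 2 < t.
  have [t2|] := leP t 2; [left|by right].
  by apply: sin_ge0_pi; have := @pi_ge2 R; lra.
have st : sin (t / 2) ^+ 2 <= (t / 2) ^+ 2.
  case: s0 => [s0|t2].
    by rewrite lerXn2r ?nnegrE// ?divr_ge0// sin_le_id// divr_ge0.
  apply: (@le_trans _ _ 1).
    by rewrite sin2cos2 lerBlDr lerDl sqr_ge0.
  by rewrite exprn_ege1//; lra.
by move: st; rewrite expr_div_n; lra.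
Qed.

Lemma sin_ge_half t : 0 <= t <= 1 -> t / 2 <= sin t.
Proof.
move=> /andP[t0 t1]; have [c] := @MVT_segment R sin cos 0 t t0
  (fun x _ => is_derive_sin x) (continuous_subspaceT (@continuous_sin R)).
rewrite in_itv/= sin0 !subr0 => /andP[c0 ct] ->.
rewrite mulrC ler_wpM2r//; apply: le_trans (cos_ge_sqr c).
have : c ^+ 2 <= 1 by rewrite exprn_ile1//; lra.
lra.
Qed.

Lemma sin_norm_bounds t : `|t| <= 1 -> `|t| / 2 <= `|sin t| <= `|t|.
Proof.
wlog t0 : t / 0 <= t => [H|].
  have [|tn] := leP 0 t; first exact: H.
  by move=> t1; have := H (- t); rewrite sinN !normrN; apply => //; lra.
rewrite (ger0_norm t0) => t1.
have h := @sin_ge_half t; rewrite ger0_norm.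
  by rewrite h ?t0//= sin_le_id.
by apply: le_trans (h _); rewrite ?t0//; lra.
Qed.

(** Inverting exp(- x / (1 + x)) >= 1 / (1 + x) gives exp(x / (1 + x)) <= 1 + x, and x - 2 x^2 <= x
    / (1 + x) once 1 + 2 x >= 0. *)
Lemma expR_le_onepx x : - (1 / 2) <= x -> expR (x - 2 * x ^+ 2) <= 1 + x.
Proof.
move=> x12; have x1 : 0 < 1 + x by lra.
apply: (@le_trans _ _ (expR (x / (1 + x)))).
  rewrite ler_expR ler_pdivlMr//.
  have -> : (x - 2 * x ^+ 2) * (1 + x) = x - x ^+ 2 * (1 + 2 * x) by ring.
  by rewrite lerBlDr lerDl mulr_ge0 ?sqr_ge0//; lra.
rewrite -[x / _]opprK expRN invf_ple ?posrE ?expR_gt0//.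
apply: le_trans (expR_ge1Dx _).
rewrite le_eqVlt; apply/orP; left; apply/eqP; field.
by rewrite gt_eqF.
Qed.

End elementary_bounds.

(** * Behaviour of sin^k exp(A cos + B sin) near its maximum *)

Section peak.
Context {R : realType}.
Variables (k : nat) (A B K : R).
Hypothesis ABK : A ^+ 2 + B ^+ 2 <= K ^+ 2.
Hypothesis K0 : 0 <= K.
Implicit Types p t : R.

Let h p := A * cos p + B * sin p.
Let h' p := B * cos p - A * sin p.
Let m p := sin p ^+ k * expR (h p).

Let h_le p : `|h p| <= K.
Proof.
rewrite -(ger0_norm K0) -[leLHS]sqrtr_sqr -[leRHS]sqrtr_sqr ler_wsqrtr//.
apply: le_trans ABK; rewrite /h.
have -> : A ^+ 2 + B ^+ 2 = (A ^+ 2 + B ^+ 2) * (cos p ^+ 2 + sin p ^+ 2).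
  by rewrite cos2Dsin2 mulr1.
rewrite -subr_ge0; set c := cos p; set s := sin p.
have -> : (A ^+ 2 + B ^+ 2) * (c ^+ 2 + s ^+ 2) - (A * c + B * s) ^+ 2 =
  (A * s - B * c) ^+ 2 by ring.
exact: sqr_ge0.
Qed.

Let h_shift p t : h (p + t) = h p * cos t + h' p * sin t.
Proof. by rewrite /h /h' cosD sinD; ring. Qed.

Let h_shift_ge p t : h p + h' p * sin t - K * t ^+ 2 <= h (p + t).
Proof.
rewrite h_shift; have := h_le p; rewrite ler_norml => /andP[hl hu].
have c1 := cos_le1 t; have ct := cos_ge_sqr t.
have : (1 - cos t) * (K - h p) >= 0 by rewrite mulr_ge0; lra.
have : K * (1 - cos t) <= K * t ^+ 2.
  by rewrite ler_wpM2l//; have := sqr_ge0 t; lra.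
by move=> *; nra.
Qed.

(** Here q is the cotangent of p, so sin(p + t) = sin p (1 + x) with x = q sin t - (1 - cos t), and
    [expR_le_onepx] bounds (1 + x)^k below. The coefficient of sin t is the logarithmic derivative
    of [m] at p; everything else is a quadratic loss. *)
Lemma profile_shift_ge p t q : 0 < sin p -> cos p = q * sin p -> `|t| <= 1 ->
  - (1 / 2) <= q * sin t - (1 - cos t) ->
  m p * expR ((k%:R * q + h' p) * sin t - (2 * k%:R + K + 4 * k%:R * q ^+ 2) * t ^+ 2)
    <= m (p + t).
Proof.
move=> sp qE t1; set x := q * sin t - (1 - cos t) => x12.
have k0 : 0 <= k%:R :> R by [].
have /andP[_ st] := sin_norm_bounds t1.
have c1 := cos_le1 t; have ct := cos_ge_sqr t.
have t2 : 0 <= t ^+ 2 by exact: sqr_ge0.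
have t21 : t ^+ 2 <= 1 by rewrite -real_normK ?num_real// exprn_ile1.
have s2 : sin t ^+ 2 <= t ^+ 2.
  by rewrite -[leLHS]real_normK ?num_real// -[leRHS]real_normK ?num_real// lerXn2r ?nnegrE.
have x2 : x ^+ 2 <= (2 * q ^+ 2 + 1 / 2) * t ^+ 2.
  have q2 : 0 <= q ^+ 2 by exact: sqr_ge0.
  have : q ^+ 2 * sin t ^+ 2 <= q ^+ 2 * t ^+ 2 by rewrite ler_wpM2l.
  have : (1 - cos t) ^+ 2 <= t ^+ 2 / 4.
    have : (1 - cos t) ^+ 2 <= (t ^+ 2 / 2) ^+ 2 by rewrite lerXn2r ?nnegrE//; lra.
    nra.
  have : 0 <= (q * sin t + (1 - cos t)) ^+ 2 by exact: sqr_ge0.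
  by rewrite /x; nra.
have sinE : sin (p + t) = sin p * (1 + x).
  by rewrite sinD /x qE; ring.
rewrite /m sinE [(_ * (1 + x)) ^+ k]exprMn -[leLHS]mulrA -[leRHS]mulrA.
rewrite ler_pM2l ?exprn_gt0// -expRD.
have px : expR (k%:R * (x - 2 * x ^+ 2)) <= (1 + x) ^+ k.
  rewrite mulrC expRM_natr lerXn2r ?nnegrE ?expR_ge0//; first lra.
  exact: expR_le_onepx.
apply: le_trans (ler_wpM2r (expR_ge0 _) px).
rewrite -expRD ler_expR.
have hs := h_shift_ge p t.
have kx2 : k%:R * x ^+ 2 <= k%:R * ((2 * q ^+ 2 + 1 / 2) * t ^+ 2) by rewrite ler_wpM2l.
have kc : k%:R * (1 - cos t) <= k%:R * (t ^+ 2 / 2) by rewrite ler_wpM2l//; lra.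
have kt : 0 <= k%:R * t ^+ 2 by rewrite mulr_ge0.
rewrite /x; rewrite /x in kx2; set y := (_ - (1 - cos t)) ^+ 2 in kx2 *.
by nra.
Qed.

Let m_gt0 p : 0 < sin p -> 0 < m p.
Proof. by move=> sp; rewrite mulr_gt0 ?expR_gt0// exprn_gt0. Qed.

(** If the logarithmic derivative were nonzero, a short step in its direction would gain linearly
    and lose only quadratically, exceeding the maximum. *)
Lemma profile_critical p q : 0 < p < pi -> cos p = q * sin p ->
  (forall t, 0 <= t <= pi -> m t <= m p) -> k%:R * q + h' p = 0.
Proof.
move=> ppi qE mmax; have sp : 0 < sin p by exact: sin_gt0_pi.
set de := _ + _; set M := 2 * k%:R + K + 4 * k%:R * q ^+ 2.
have M0 : 0 <= M by rewrite !addr_ge0// mulr_ge0// sqr_ge0.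
apply/eqP; apply: contraT => de0.
have nde : 0 < `|de| by rewrite normr_gt0.
(* The first two bounds keep x >= -1/2, the next two keep p + t in [0, pi], and the last makes the
   loss M e^2 at most |de| e / 4, below the gain |de| sin e >= |de| e / 2. *)
pose e := Num.min (Num.min (1 / 2) (1 / (4 * (`|q| + 1))))
                  (Num.min (Num.min p (pi - p)) (`|de| / (4 * (M + 1)))).
have q1 : 0 < 4 * (`|q| + 1) by rewrite mulr_gt0// ltr_wpDl.
have M1 : 0 < 4 * (M + 1) by rewrite mulr_gt0// ltr_wpDl.
case/andP : (ppi) => p0 p1.
have e0 : 0 < e by rewrite !lt_min !divr_gt0// p0/= subr_gt0 p1.
have e2 : e <= 1 / 2 by rewrite !ge_min lexx.
have eq4 : e * (4 * (`|q| + 1)) <= 1.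
  by rewrite -ler_pdivlMr// !ge_min lexx/= ?orbT.
have ep : e <= p by rewrite !ge_min lexx/= ?orbT.
have epi : e <= pi - p by rewrite !ge_min lexx/= ?orbT.
have edM : e * (4 * (M + 1)) <= `|de|.
  by rewrite -ler_pdivlMr// !ge_min lexx/= ?orbT.
pose t := Num.sg de * e.
have nt : `|t| = e by rewrite normrM normr_sg de0 mul1r gtr0_norm.
have t2 : t ^+ 2 = e ^+ 2 by rewrite -[LHS]real_normK ?num_real// nt.
have sint : de * sin t = `|de| * sin e.
  by rewrite sin_sg mulrA [de * _]mulrC -normrEsg.
have t1 : `|t| <= 1 by rewrite nt; lra.
have /andP[_ st] := sin_norm_bounds t1; rewrite nt in st.
have ct := cos_ge_sqr t; rewrite t2 in ct.
have x12 : - (1 / 2) <= q * sin t - (1 - cos t).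
  have qs : `|q * sin t| <= `|q| * e by rewrite normrM ler_wpM2l.
  have := lerNnormlW qs; have := normr_ge0 q; nra.
have := profile_shift_ge sp qE t1 x12.
rewrite -/de -/M t2 sint => le1.
have tpi : 0 <= p + t <= pi.
  by have := ler_norm t; have := lerNnormlW (lexx `|t|); rewrite nt => ? ?; apply/andP; split; lra.
have := le_trans le1 (mmax _ tpi).
rewrite -[leRHS]mulr1 ler_pM2l ?m_gt0// -[leRHS]expR0 ler_expR.
have se : e / 2 <= sin e by apply: sin_ge_half; apply/andP; split; lra.
have : `|de| * (e / 2) <= `|de| * sin e by rewrite ler_wpM2l.
have : e * (e * (4 * (M + 1))) <= e * `|de| by rewrite ler_wpM2l// ltW.
have : 0 < e * `|de| by rewrite mulr_gt0.
have : 0 <= M * e ^+ 2 by rewrite mulr_ge0// sqr_ge0.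
have : 0 <= e ^+ 2 by exact: sqr_ge0.
by nra.
Qed.

(* At the maximum the term linear in [t] of [profile_shift_ge] cancels, and the
   quadratic one is at most [5 (k + 1 + K) t ^ 2]. *)
Lemma profile_peak p w t : 0 <= B -> 0 <= p <= pi / 2 ->
  (forall t, 0 <= t <= pi -> m t <= m p) ->
  0 < w -> w ^+ 2 * (k.+1%:R + K) = 1 -> 0 <= t <= w ->
  m p * expR (- 5) <= m (p + t) /\ k%:R * cos p ^+ 2 <= K * sin p ^+ 2.
Proof.
move=> B0 /andP[p0 p2] mmax w0 wK /andP[t0 tw].
have pi2 := @pi_ge2 R.
have k0 : 0 <= k%:R :> R by [].
have k1 : k.+1%:R = k%:R + 1 :> R by rewrite -natr1.
have w1 : w <= 1.
  rewrite leNgt; apply/negP => w1; have : 1 < w ^+ 2 by rewrite exprn_egt1.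
  have : 0 <= w ^+ 2 * (k%:R + K) by rewrite mulr_ge0 ?sqr_ge0// addr_ge0.
  by move: wK; rewrite k1; lra.
have t2 : t ^+ 2 * (k%:R + 1 + K) <= 1.
  rewrite -k1 -[leRHS]wK ler_wpM2r ?addr_ge0// lerXn2r ?nnegrE//; last exact: ltW.
have tt : 0 <= t ^+ 2 by exact: sqr_ge0.
have st0 : 0 <= sin t by apply: sin_ge0_pi; apply/andP; split; lra.
have cp0 : 0 <= cos p by apply: cos_ge0_pihalf; apply/andP; split; lra.
have ct := cos_ge_sqr t.
have hs := h_shift_ge p t.
(* The cotangent is undefined at 0. A maximum there forces k = 0, since otherwise m 0 = 0 < m (pi /
   2); then h'(0) = B >= 0 suffices. *)
have [pp0|pn0] := eqVneq p 0.
  have k00 : k = 0%N.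
    apply/eqP; rewrite -leqn0 leqNgt; apply/negP => kgt0.
    have : m (pi / 2) <= m p by apply: mmax; apply/andP; split; lra.
    rewrite /m pp0 sin0 expr0n eqn0Ngt kgt0 mul0r leNgt.
    by move/negP; apply; apply: m_gt0; rewrite sin_pihalf.
  rewrite k00 mul0r mulr_ge0// ?sqr_ge0//; split=> //.
  rewrite /m k00 !expr0 !mul1r -expRD ler_expR; apply: le_trans hs.
  have : 0 <= h' p * sin t.
    by rewrite mulr_ge0// /h' pp0 cos0 sin0 mulr1 mulr0 subr0.
  by move: t2; rewrite k00; nra.
have ppi : 0 < p < pi by rewrite lt_neqAle eq_sym pn0 p0/=; lra.
have sp : 0 < sin p by exact: sin_gt0_pi.
pose q := cos p / sin p.
have qE : cos p = q * sin p by rewrite divfK// gt_eqF.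
have q0 : 0 <= q by rewrite divr_ge0// ltW.
have crit := profile_critical ppi qE mmax.
have AK : A <= K.
  by have := h_le 0; rewrite /h cos0 sin0 mulr1 mulr0 addr0; apply: le_trans (ler_norm _).
(* Criticality reads k q + B cos p = A sin p; the term B cos p is nonnegative and A <= K. *)
have kc : k%:R * q <= K * sin p.
  have Ah : k%:R * q + B * cos p = A * sin p by move: crit; rewrite /h'; lra.
  have : A * sin p <= K * sin p by rewrite ler_wpM2r// ltW.
  have : 0 <= B * cos p by rewrite mulr_ge0.
  by move: Ah; lra.
have kc2 : k%:R * cos p ^+ 2 <= K * sin p ^+ 2.
  have -> : k%:R * cos p ^+ 2 = (k%:R * q) * sin p * cos p by rewrite expr2 {1}qE; ring.
  have -> : K * sin p ^+ 2 = K * sin p * sin p * 1 by ring.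
  apply: ler_pM; [|exact: cp0| |exact: cos_le1].
    by rewrite mulr_ge0 ?(ltW sp)// mulr_ge0.
  by rewrite ler_wpM2r// ltW.
(* This turns the loss 2 k + K + 4 k q^2 into at most 2 k + 5 K, whence the constant 5. *)
have kq2 : k%:R * q ^+ 2 <= K.
  rewrite -(@ler_pM2r _ (sin p ^+ 2)) ?exprn_gt0//.
  by rewrite (_ : k%:R * q ^+ 2 * sin p ^+ 2 = k%:R * cos p ^+ 2)//; rewrite qE; ring.
split=> //.
have x12 : - (1 / 2) <= q * sin t - (1 - cos t).
  have : 0 <= q * sin t by rewrite mulr_ge0.
  have : t ^+ 2 <= 1 by rewrite exprn_ile1//; lra.
  lra.
have t1 : `|t| <= 1 by rewrite ger0_norm//; lra.
apply: le_trans (profile_shift_ge sp qE t1 x12).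
rewrite crit mul0r sub0r ler_wpM2l ?(ltW (m_gt0 _))// ler_expR.
have : k%:R * q ^+ 2 * t ^+ 2 <= K * t ^+ 2 by rewrite ler_wpM2r.
have : 0 <= k%:R * t ^+ 2 by rewrite mulr_ge0.
have : 0 <= K * t ^+ 2 by rewrite mulr_ge0.
by nra.
Qed.

End peak.

(** * A window of nearly maximal values for the angular kernel *)

Section angular_peak.
Context {R : realType}.
Local Notation mu := (@lebesgue_measure R).
Variables (J : R -> R) (k : nat) (be K w : R).
Hypothesis Jt : log_tilted J.
Hypotheses (be0 : 0 <= be) (K0 : 0 <= K) (w0 : 0 < w).
Hypothesis wK : w ^+ 2 * (k.+1%:R + K) = 1.
Implicit Types al t p : R.

Let J0 c : 0 < J c. Proof. by have [] := Jt. Qed.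

Lemma continuous_angular al : continuous (angular J k al be).
Proof.
apply: continuous_fM; first exact/continuous_fX/continuous_sin.
have cZ c (h : R -> R) : continuous h -> continuous (fun t => c * h t).
  by move=> ch; apply: continuous_fM; [move=> t; exact: cvg_cst|].
apply: continuous_fM.
  exact: (continuous_fcomp (cZ _ _ (@continuous_cos R)) (@continuous_expR R)).
by apply: (continuous_fcomp (cZ _ _ (@continuous_sin R))); have [] := Jt.
Qed.

Lemma angular_reflect al t : angular J k al be (pi - t) = angular J k (- al) be t.
Proof.
rewrite /angular sinB cosB sinpi cospi.
by congr (_ ^+ _ * (expR _ * J (_ * _))); ring.
Qed.

Let w1 : w <= 1.
Proof.
rewrite leNgt; apply/negP => w1; have : 1 < w ^+ 2 by rewrite exprn_egt1.
have : 0 <= w ^+ 2 * (k%:R + K) by rewrite mulr_ge0 ?sqr_ge0// addr_ge0.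
by move: wK; rewrite -natr1; lra.
Qed.

Let peak_window al a := [/\ 0 <= a, a + w / 2 <= pi &
  forall t, a <= t <= a + w / 2 ->
    (forall p, 0 <= p <= pi -> angular J k al be p * expR (- 5) <= angular J k al be t) /\
    Num.sqrt k.+1%:R * w / 8 <= sin t].

Let peak_window_left al p : al ^+ 2 + be ^+ 2 <= K ^+ 2 -> 0 <= p <= pi / 2 ->
  (forall t, 0 <= t <= pi -> angular J k al be t <= angular J k al be p) ->
  peak_window al (p + w / 2).
Proof.
move=> aK pI pmax; case/andP : (pI) => p0 p2.
have pi2 := @pi_ge2 R.
have sp0 : 0 <= sin p by apply: sin_ge0_pi; apply/andP; split; lra.
have cp0 : 0 <= cos p by apply: cos_ge0_pihalf; apply/andP; split; lra.
(* The tangent exponential is taken at the point where the maximum evaluates [J], so the minorant D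
   m meets the kernel at p and inherits p as a maximum; ka >= 0 supplies the sign of B that
   [profile_peak] asks for. *)
have [ka [/andP[ka0 ka1] Jka]] := log_tilted_ge0 Jt (mulr_ge0 be0 sp0).
pose B := be * ka.
have aBK : al ^+ 2 + B ^+ 2 <= K ^+ 2.
  apply: le_trans aK; rewrite lerD2l exprMn ler_piMr ?sqr_ge0// exprn_ile1//.
pose D := J (be * sin p) * expR (- (ka * (be * sin p))).
have D0 : 0 < D by rewrite mulr_gt0 ?expR_gt0.
pose m t := sin t ^+ k * expR (al * cos t + B * sin t).
have Dm t : 0 <= t <= pi -> D * m t <= angular J k al be t.
  move=> tpi; rewrite /angular /m mulrCA ler_wpM2l ?exprn_ge0 ?sin_ge0_pi//.
  rewrite expRD mulrCA ler_wpM2l ?expR_ge0//.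
  apply: le_trans (Jka (be * sin t)); rewrite /D -mulrA -expRD /B.
  by rewrite le_eqVlt; apply/orP; left; apply/eqP; congr (_ * expR _); ring.
have Dmp : D * m p = angular J k al be p.
  rewrite /angular /m /D expRD /B expRN.
  have -> : be * ka * sin p = ka * (be * sin p) by ring.
  by field; rewrite gt_eqF ?expR_gt0.
have mmax t : 0 <= t <= pi -> m t <= m p.
  move=> tpi; rewrite -(ler_pM2l D0) Dmp; apply: le_trans (Dm _ tpi) _; exact: pmax.
have B0 : 0 <= B by rewrite mulr_ge0.
have peak t : 0 <= t <= w -> m p * expR (- 5) <= m (p + t) /\
    k%:R * cos p ^+ 2 <= K * sin p ^+ 2.
  exact: (profile_peak aBK K0 B0 pI mmax w0 wK).
have [wpos wle1] := (w0, w1); have KK := K0.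
split; [lra|lra|] => u /andP[u1 u2].
pose t := u - p.
have tI : 0 <= t <= w by rewrite /t; apply/andP; split; lra.
have uE : u = p + t by rewrite /t; ring.
have [mt kc] := peak t tI.
split.
  move=> s spi; apply: (@le_trans _ _ (angular J k al be p * expR (- 5))).
    by rewrite ler_wpM2r ?expR_ge0// pmax.
  rewrite -Dmp -mulrA; apply: le_trans (Dm u _); last by apply/andP; split; lra.
  by rewrite uE ler_wpM2l// ltW.
have t0 : 0 <= t by rewrite /t; lra.
have t1 : t <= 1 by rewrite /t; lra.
have ct := cos_ge_sqr t.
have st : t / 2 <= sin t by apply: sin_ge_half; rewrite t0.
have tt : t ^+ 2 <= 1 by rewrite exprn_ile1.
(* Here t >= w / 2: if p is near 0 the sine is small at p itself, and the second half of the window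
   secures a size of order w. *)
have sE : sin p * (1 / 2) + cos p * (w / 4) <= sin u.
  rewrite uE sinD; apply: lerD; rewrite ler_wpM2l//; first lra.
  by move: st; rewrite /t; lra.
have sc1 : 1 <= sin p + cos p.
  have sc0 : 0 <= sin p * cos p by rewrite mulr_ge0.
  rewrite leNgt; apply/negP => sc.
  have : 0 < (1 - (sin p + cos p)) * (1 + (sin p + cos p)) by rewrite mulr_gt0//; lra.
  by have := cos2Dsin2 p; nra.
pose r := Num.sqrt k%:R : R.
have r0 : 0 <= r by exact: sqrtr_ge0.
(* From k cos(p)^2 <= K sin(p)^2 follows k <= (k + K) sin(p)^2, and w^2 (k + K) <= 1. *)
have rw : r * w <= sin p.
  rewrite -ler_sqr ?nnegrE// ?mulr_ge0// ?(ltW w0)// exprMn sqr_sqrtr//.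
  have -> : k%:R * w ^+ 2 = w ^+ 2 * (k%:R * (cos p ^+ 2 + sin p ^+ 2)).
    by rewrite cos2Dsin2 mulr1 mulrC.
  apply: (@le_trans _ _ (w ^+ 2 * ((k%:R + K) * sin p ^+ 2))).
    by rewrite ler_wpM2l ?sqr_ge0//; lra.
  rewrite mulrA ler_piMl ?sqr_ge0// -[leRHS]wK ler_wpM2l ?sqr_ge0// -natr1; lra.
have rS : Num.sqrt k.+1%:R <= r + 1 :> R.
  rewrite -ler_sqr ?nnegrE ?sqrtr_ge0// ?addr_ge0// sqr_sqrtr// sqrrD sqr_sqrtr//.
  by rewrite -natr1; lra.
have : Num.sqrt k.+1%:R * w <= (r + 1) * w by rewrite ler_wpM2r// ltW.
have : w * 1 <= w * (sin p + cos p) by rewrite ler_wpM2l// ltW.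
have : w * sin p <= 1 * sin p by rewrite ler_wpM2r.
by move: sE rw; nra.
Qed.

(** A maximum to the right of pi / 2 is brought to the left by t -> pi - t, which changes [al] into
    [- al]. *)
Lemma angular_peak_window al : al ^+ 2 + be ^+ 2 <= K ^+ 2 -> exists a, peak_window al a.
Proof.
move=> aK; have pi2 := @pi_ge2 R; have [wpos wle1] := (w0, w1).
have [p pI pmax] : exists2 p, p \in `[0, pi]%R & forall t, t \in `[0, pi]%R ->
    angular J k al be t <= angular J k al be p.
  by apply: EVT_max; [lra|exact/continuous_subspaceT/continuous_angular].
have {}pmax t : 0 <= t <= pi -> angular J k al be t <= angular J k al be p.
  by move=> tpi; apply: pmax; rewrite in_itv.
move: pI; rewrite in_itv/= => /andP[p0 p1].
have [p2|p2] := leP p (pi / 2).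
  by exists (p + w / 2); apply: peak_window_left => //; rewrite p0.
have aK' : (- al) ^+ 2 + be ^+ 2 <= K ^+ 2 by rewrite sqrrN.
have [|t tpi|a0 a1 aP] := @peak_window_left (- al) (pi - p) aK' _ _.
- by apply/andP; split; lra.
- rewrite -angular_reflect -[leRHS]angular_reflect subKr.
  by apply: pmax; apply/andP; split; lra.
set a := pi - p + w / 2 in a0 a1 aP.
exists (pi - a - w / 2); split; [lra|lra|] => t /andP[t1 t2].
have [|tP ts] := aP (pi - t); first by apply/andP; split; lra.
split; last by move: ts; rewrite sinB sinpi cospi; lra.
move=> s /andP[s0 s1]; have := tP (pi - s).
by rewrite -!angular_reflect !subKr; apply; apply/andP; split; lra.
Qed.

(** The window of exponent k serves both integrals: raising the exponent by one multiplies the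
    kernel by sin t, which is bounded below on that window. *)
Lemma angular_integral_ge al p : al ^+ 2 + be ^+ 2 <= K ^+ 2 -> 0 <= p <= pi ->
  angular J k al be p * expR (- 5) * (w / 2) <=
    \int[mu]_(t in `[0, pi]) angular J k al be t /\
  angular J k al be p * expR (- 5) * (Num.sqrt k.+1%:R * w / 8) * (w / 2) <=
    \int[mu]_(t in `[0, pi]) angular J k.+1 al be t.
Proof.
move=> aK ppi; have [a [a0 a1 aP]] := angular_peak_window aK.
have w2 : w / 2 = a + w / 2 - a by ring.
have wpos := w0.
have G0 : 0 <= angular J k al be p * expR (- 5).
  by rewrite mulr_ge0 ?expR_ge0// angular_ge0.
have s0 : 0 <= Num.sqrt k.+1%:R * w / 8 by rewrite !mulr_ge0 ?sqrtr_ge0// ltW.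
split; rewrite {1}w2.
  apply: Rintegral_0pi_ge => //; [exact: continuous_angular|
    by move=> t; exact: angular_ge0|lra|].
  by move=> t tI; have [+ _] := aP t tI; apply.
have angularS t : angular J k.+1 al be t = angular J k al be t * sin t.
  by rewrite /angular exprS; ring.
apply: Rintegral_0pi_ge => //.
- have -> : angular J k.+1 al be = fun t => angular J k al be t * sin t.
    exact/funext.
  by apply: continuous_fM; [exact: continuous_angular|exact: continuous_sin].
- by move=> t; exact: angular_ge0.
- lra.
- by rewrite mulr_ge0.
move=> t tI; rewrite angularS; have [tG ts] := aP t tI.
by rewrite ler_pM// tG.
Qed.

End angular_peak.

(** * Bounds on the normalised angular kernel *)

Section angular_density_bounds.
Context {R : realType}.
Local Notation mu := (@lebesgue_measure R).
Variables (J : R -> R) (al be K : R).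
Hypothesis Jt : log_tilted J.
Hypotheses (K0 : 0 <= K) (abK : al ^+ 2 + be ^+ 2 <= K ^+ 2).

(** The second coordinate of the rotated mean may be negative; evenness of [J] reduces to be >=
    0. *)
Let angular_norm k t : angular J k al be t = angular J k al `|be| t.
Proof.
rewrite /angular; have [b0|b0] := leP 0 be; first by rewrite ger0_norm.
by have [_ _ JN _] := Jt; rewrite ltr0_norm// mulNr JN.
Qed.

Let abK' : al ^+ 2 + `|be| ^+ 2 <= K ^+ 2.
Proof. by rewrite real_normK ?num_real. Qed.

Let I k := \int[mu]_(t in `[0, pi]) angular J k al be t.

Let I_norm k : I k = \int[mu]_(t in `[0, pi]) angular J k al `|be| t.
Proof. by rewrite /I; congr (Rintegral _ _ _); apply/funext => t; exact: angular_norm. Qed.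

Let I_gt0 k : 0 < I k.
Proof.
have J0 : forall c, 0 < J c by have [] := Jt.
rewrite I_norm; apply: Rintegral_0pi_gt0.
- exact: continuous_angular.
- by move=> t; exact: angular_ge0.
- by move=> t; exact: angular_gt0.
Qed.

Lemma angular_density_le k t : 0 <= t <= pi ->
  angular J k al be t / I k <= 2 * expR 5 * Num.sqrt (k.+1%:R + K).
Proof.
move=> tpi; set S := k.+1%:R + K.
have S0 : 0 < S by rewrite ltr_wpDr.
pose w := (Num.sqrt S)^-1.
have s0 : 0 < Num.sqrt S by rewrite sqrtr_gt0.
have w0 : 0 < w by rewrite invr_gt0.
have wK : w ^+ 2 * S = 1 by rewrite exprVn sqr_sqrtr ?mulVf ?gt_eqF// ltW.
have [+ _] := angular_integral_ge Jt (normr_ge0 be) K0 w0 wK abK' tpi.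
rewrite -I_norm -angular_norm expRN /w => le1.
rewrite ler_pdivrMr//.
have e0 := expR_gt0 (5 : R).
have -> : angular J k al be t = 2 * expR 5 * Num.sqrt S *
    (angular J k al be t * (expR 5)^-1 * ((Num.sqrt S)^-1 / 2)).
  by field; rewrite !gt_eqF.
by rewrite ler_wpM2l// !mulr_ge0// ltW.
Qed.

(** Dividing by sin t lowers the exponent to k - 1, whose window has w^2 = 1 / (k + K). The factors
    1/8 and 1/2 of the second integral bound give 16, and (k + K) / sqrt k is the stated sum. *)
Lemma angular_density_div_sin_le k t : (0 < k)%N -> 0 < t < pi ->
  angular J k al be t / I k / sin t <= 16 * expR 5 * (Num.sqrt k%:R + K / Num.sqrt k%:R).
Proof.
case: k => // k _ tpi; set S := k.+1%:R + K.
have S0 : 0 < S by rewrite ltr_wpDr.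
have st : 0 < sin t by exact: sin_gt0_pi.
pose w := (Num.sqrt S)^-1.
have s0 : 0 < Num.sqrt S by rewrite sqrtr_gt0.
have w0 : 0 < w by rewrite invr_gt0.
have w2 : w ^+ 2 = S^-1 by rewrite exprVn sqr_sqrtr// ltW.
have wK : w ^+ 2 * S = 1 by rewrite w2 mulVf// gt_eqF.
have tpi' : 0 <= t <= pi by case/andP : tpi => /ltW-> /ltW->.
have [_] := angular_integral_ge Jt (normr_ge0 be) K0 w0 wK abK' tpi'.
rewrite -I_norm -angular_norm expRN.
set r := Num.sqrt k.+1%:R; set G := angular J k al be t => le1.
have r0 : 0 < r by rewrite sqrtr_gt0.
have r2 : r ^+ 2 = k.+1%:R by rewrite sqr_sqrtr.
have -> : angular J k.+1 al be t / I k.+1 / sin t = G / I k.+1.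
  by rewrite /G /angular exprS; field; rewrite !gt_eqF.
rewrite ler_pdivrMr//.
have -> : r + K / r = S / r by rewrite /S -r2; field; rewrite gt_eqF.
have e0 := expR_gt0 (5 : R).
have -> : G = 16 * expR 5 * (S / r) * (G / expR 5 * (r * w / 8) * (w / 2)).
  transitivity (G * (w ^+ 2 * S)); first by rewrite wK mulr1.
  by field; rewrite !gt_eqF.
by rewrite ler_wpM2l// !mulr_ge0 ?invr_ge0// ltW.
Qed.

End angular_density_bounds.

Lemma sqrtrSS_bounds {R : rcfType} n : (0 < n)%N ->
  (Num.sqrt n%:R : R) <= (Num.sqrt n.+2%:R : R) <= 2 * (Num.sqrt n%:R : R).
Proof.
move=> n0; apply/andP; split; first by rewrite ler_wsqrtr// ler_nat -addn2 leq_addr.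
have -> : 2 = Num.sqrt 4%:R :> R by rewrite -[4%N]/(2 ^ 2)%N natrX sqrtr_sqr ger0_norm.
rewrite -sqrtrM// ler_wsqrtr// -natrM ler_nat -[n.+2]/(2 + n)%N mulSn addnC leq_add2l.
by rewrite (leq_trans _ (leq_pmulr 3 n0)).
Qed.

Theorem theorem1 (R : realType) :
  exists C1 C2 : R,
  forall (d : nat) (sigma : R) (p v x mu : 'rV[R]_d)
    (disp : measure_display) (T : measurableType disp) (P : probability T R)
    (y : T -> 'rV[R]_d),
  (2 <= d)%N -> 0 < sigma -> v != 0 -> line p v x ->
  isotropic_gaussian P mu sigma y ->
  let phi := fun t : T => angle v (x - y t) in
  let rho := fun t : T => enorm (x - y t) in
  let s := enorm (x - mu) in
  (exists f : R -> R -> R, conditional_angle_density P phi rho f) /\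
  forall f : R -> R -> R, conditional_angle_density P phi rho f ->
  forall r : R, 0 < r ->
    (ereal_sup [set (f r a)%:E | a in `[0, pi]%classic]%R <=
       (C1 * (Num.sqrt d%:R + Num.sqrt (r * s) / sigma))%R%:E)%E /\
    ((3 <= d)%N ->
     (ereal_sup [set (f r a / sin a)%:E | a in `]0, pi[%classic]%R <=
        (C2 * (Num.sqrt d%:R + r * s / (sigma ^+ 2 * Num.sqrt d%:R)))%R%:E)%E).
Proof.
(* The second constant is twice 16 e^5: the kernel estimate involves sqrt(d - 2), and sqrt d <= 2
   sqrt(d - 2) for d >= 3. *)
exists (2 * expR 5), (32 * expR 5) => d sigma p v x mu disp T P y.
case: d p v x mu y => [|[|n]]// p v x mu y _ sigma0 v0 _ yP phi rho s.
have sn0 : sigma != 0 by rewrite gt_eqF.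
have zP := isotropic_gaussian_subl x sn0 yP.
have [C [a0 [b [C0 ab [mphi phi_itv] mrho law]]]] := angle_radius_law sn0 v0 zP.
pose J : R -> R := axial_factor n.
have Jt : log_tilted J by exact: log_tilted_axial_factor.
have J0 c : 0 < J c by have [] := Jt.
pose q := radius_weight n sigma C.
have mq : measurable_fun [set: R] q.
  apply: measurable_funM; first exact: measurable_indic.
  apply: measurable_funM => //; apply: measurable_funM; first exact: measurable_funX.
  exact: measurable_normal_fun.
have q_gt0 r : 0 < r -> 0 < q r.
  move=> r0; rewrite /q /radius_weight indicE mem_set/=; last by rewrite in_itv/= r0.
  by rewrite mul1r !mulr_gt0 ?exprn_gt0 ?expR_gt0.
have q_ge0 r : 0 <= q r.
  have [r0|r0] := ltP 0 r; first exact/ltW/q_gt0.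
  rewrite /q /radius_weight indicE memNset ?mul0r//=.
  by rewrite in_itv/= andbT; apply/negP; rewrite -leNgt.
pose G := angle_kernel n sigma a0 b.
have G_ge0 r t : 0 <= t <= pi -> 0 <= G (r, t) by exact: angular_ge0.
have G_gt0 r t : 0 < t < pi -> 0 < G (r, t) by exact: angular_gt0.
have cG : continuous G by exact: continuous_angle_kernel.
have mG : measurable_fun [set: R * R] G by exact: measurable_angle_kernel.
split.
  exists (fun r t => G (r, t) / \int[lebesgue_measure]_(t in `[0, pi]) G (r, t)).
  exact: (conditional_density_exists mrho mq phi_itv q_ge0 cG mG G_ge0 G_gt0 law).
move=> f fP r r0.
have f_le t : 0 <= t <= pi -> f r t <= G (r, t) / \int[lebesgue_measure]_(t in `[0, pi]) G (r, t).
  exact: (conditional_density_le mrho mq mphi phi_itv q_ge0 q_gt0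
    cG mG G_ge0 G_gt0 law fP r0).
have s0 : 0 <= s by exact: sqrtr_ge0.
pose K := r * s / sigma ^+ 2.
have K0 : 0 <= K by rewrite !mulr_ge0 ?invr_ge0 ?sqr_ge0// ltW.
pose al := a0 * r / sigma ^+ 2; pose be := b * r / sigma ^+ 2.
have abK : al ^+ 2 + be ^+ 2 <= K ^+ 2.
  rewrite le_eqVlt; apply/orP; left; apply/eqP.
  transitivity ((a0 ^+ 2 + b ^+ 2) * (r / sigma ^+ 2) ^+ 2).
    by rewrite /al /be; ring.
  by rewrite ab /K -/s; ring.
split.
  apply: ge_ereal_sup => z [a /=]; rewrite in_itv/= => api <-; rewrite lee_fin.
  apply: (le_trans (f_le a api)).
  apply: (le_trans (angular_density_le Jt K0 abK n api)).
  rewrite ler_wpM2l ?mulr_ge0 ?expR_ge0//.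
  have -> : Num.sqrt (r * s) / sigma = Num.sqrt K.
    rewrite [RHS]sqrtrM; last by rewrite mulr_ge0// ltW.
    by rewrite sqrtrV ?sqr_ge0// sqrtr_sqr gtr0_norm.
  (* After squaring, d - 1 + K is compared with d + K plus a nonnegative cross term. *)
  rewrite -ler_sqr ?nnegrE ?addr_ge0 ?sqrtr_ge0//.
  rewrite sqr_sqrtr ?addr_ge0// sqrrD !sqr_sqrtr//.
  have : 0 <= Num.sqrt n.+2%:R * Num.sqrt K :> R by rewrite mulr_ge0 ?sqrtr_ge0.
  by rewrite -(natr1 n.+1); lra.
rewrite !ltnS => n0.
apply: ge_ereal_sup => z [a /=]; rewrite in_itv/= => api <-; rewrite lee_fin.
have sa0 : 0 < sin a by exact: sin_gt0_pi.
have api' : 0 <= a <= pi by case/andP : api => /ltW-> /ltW->.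
have le1 : f r a / sin a <= angular J n al be a /
    (\int[lebesgue_measure]_(t in `[0, pi]) angular J n al be t) / sin a.
  by rewrite ler_wpM2r ?invr_ge0 ?(ltW sa0)//; exact: f_le.
apply: (le_trans le1).
apply: (le_trans (angular_density_div_sin_le Jt K0 abK n0 api)).
have -> : 32 * expR 5 = 16 * expR 5 * 2 :> R by ring.
rewrite -[leRHS]mulrA ler_wpM2l ?mulr_ge0 ?expR_ge0//.
have r0' : 0 < Num.sqrt n%:R :> R by rewrite sqrtr_gt0 ltr0n.
have S0 : 0 < Num.sqrt n.+2%:R :> R by rewrite sqrtr_gt0.
have /andP[rS Sr] := @sqrtrSS_bounds R _ n0.
have -> : r * s / (sigma ^+ 2 * Num.sqrt n.+2%:R) = K / Num.sqrt n.+2%:R.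
  by rewrite /K invfM mulrA.
have : K / Num.sqrt n%:R <= 2 * (K / Num.sqrt n.+2%:R).
  rewrite mulrCA ler_wpM2l// ler_pdivlMr// mulrC ler_pdivrMr//.
by move: S0; lra.
Qed.
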